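(* For every real number $\alpha>0$ and every prime $p$, there exists a finitely generated group $\Gamma$ such that $RG_p(\Gamma)=\alpha$.
   Context: For a group $A$ let $d(A)$ be the minimal number of generators of $A$, and let $d_p(A)=d\big(A/[A,A]A^p\big)$. For a finitely generated group $G$ and a prime $p$, the $p$-gradient is $RG_p(G)=\inf_H \frac{d_p(H)-1}{[G:H]}$, where the infimum is over all normal subgroups $H\trianglelefteq G$ with $[G:H]=p^k$ for some integer $k\ge 0$. *)

(* Defs.v *)
From Stdlib Require Import Reals ZArith Znumtheory.
Open Scope R_scope.

Record Group : Type := {
  carrier :> Type;
  gmul : carrier -> carrier -> carrier;
  ginv : carrier -> carrier;
  gone : carrier;
  gmul_assoc : forall x y z, gmul x (gmul y z) = gmul (gmul x y) z;
  gmul_1l : forall x, gmul gone x = x;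
  gmul_Vl : forall x, gmul (ginv x) x = gone
}.

Section GroupDefs.
Variable G : Group.

Definition is_subgroup (H : G -> Prop) : Prop :=
  H (gone G) /\ (forall x y, H x -> H y -> H (gmul G x y)) /\
  (forall x, H x -> H (ginv G x)).

Definition is_normal (H : G -> Prop) : Prop :=
  is_subgroup H /\
  forall g x, H x -> H (gmul G (gmul G (ginv G g) x) g).

Definition gen (S : G -> Prop) : G -> Prop :=
  fun x => forall K, is_subgroup K -> (forall s, S s -> K s) -> K x.

Definition fin_gen : Prop :=
  exists (n : nat) (g : nat -> G),
    forall x, gen (fun y => exists i, (i < n)%nat /\ y = g i) x.

(** [G : H] = n : there are n left coset representatives r_0..r_{n-1} such that
    every x lies in exactly one coset r_i H. *)
Definition has_index (H : G -> Prop) (n : nat) : Prop :=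
  exists r : nat -> G,
    forall x, exists i, (i < n)%nat /\ H (gmul G (ginv G (r i)) x) /\
      forall j, (j < n)%nat -> H (gmul G (ginv G (r j)) x) -> j = i.

Definition pow (x : G) : nat -> G :=
  fix f k := match k with O => gone G | S k' => gmul G x (f k') end.

Definition comm (x y : G) : G :=
  gmul G (gmul G (ginv G x) (ginv G y)) (gmul G x y).

Definition frattini_p (p : nat) (H : G -> Prop) : G -> Prop :=
  gen (fun y => (exists a b, H a /\ H b /\ y = comm a b) \/
                (exists a, H a /\ y = pow a p)).

(** The images of h_0..h_{n-1} (elements of H) generate H/[H,H]H^p. *)
Definition generates_mod_p (p : nat) (H : G -> Prop) (n : nat) : Prop :=
  exists h : nat -> G,
    (forall i, (i < n)%nat -> H (h i)) /\
    (forall x, H x ->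
       gen (fun y => (exists i, (i < n)%nat /\ y = h i) \/ frattini_p p H y) x).

Definition dp_is (p : nat) (H : G -> Prop) (n : nat) : Prop :=
  generates_mod_p p H n /\ forall m, generates_mod_p p H m -> (n <= m)%nat.

Definition p_gradient_values (p : nat) : R -> Prop :=
  fun r => exists (H : G -> Prop) (k n : nat),
    is_normal H /\ has_index H (p ^ k) /\ dp_is p H n /\
    r = (INR n - 1) / INR (p ^ k).

End GroupDefs.

Definition is_inf (S : R -> Prop) (a : R) : Prop :=
  (forall r, S r -> a <= r) /\
  (forall b, (forall r, S r -> b <= r) -> b <= a).

Definition p_gradient_is (G : Group) (p : nat) (a : R) : Prop :=
  is_inf (p_gradient_values G p) a.

(* Main.v *)
From Stdlib Require Import Reals ZArith Znumtheory Lra.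
From mathcomp Require Import all_boot all_algebra all_fingroup cyclic pgroup.
From mathcomp Require Import boolp classical_sets zify.
Require Import Defs.

(** Start from the group presented by generators a, b, t, s, z_0, ..., z_(k-1),
    where s commutes with a, b and t and k >= alpha; its p-gradient is at least k,
    because for a normal subgroup H of index n the cocycles with values in
    functions G/H -> F_p give at least p^(nk+1) homomorphisms H -> F_p.
    Killing a power w^q, with q a power of p, lowers the p-gradient by at most
    1/q, and the condition "p-gradient at least alpha" passes to the union of a
    chain of sets of relators.  By Zorn's lemma there is a maximal set E of
    relators of the form (z_l c_i)^(q_i), with c_i = [a, t^-i b t^i], for which
    the p-gradient is still at least alpha.  If it exceeded alpha by 1/q, then E
    would contain all the candidates with q_i >= q, hence infinitely many with
    q_i = q.  But in suitable finite p-quotients killing the z_l, n of the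
    corresponding c_i have order q and are independent, all other c_i die, and s
    maps to a central element of large order m; this bounds the p-gradient by
    4/m + k(1 - 1/q)^n, which can be made smaller than alpha. *)

Set Implicit Arguments.
Unset Strict Implicit.
Unset Printing Implicit Defensive.

Import GRing.Theory.
(* The key R belongs to ring_scope from here on. *)
Delimit Scope R_scope with Re.
Close Scope R_scope.
Local Open Scope nat_scope.

Declare Scope grp_scope.
Notation "x ** y" := (gmul _ x y) (at level 40, left associativity) : grp_scope.
Notation "x ^v" := (ginv _ x) (at level 2, left associativity, format "x ^v") : grp_scope.
Notation one := (gone _).
Notation Grp := Defs.Group.
Local Open Scope grp_scope.

(** * Groups and subgroups *)

Section GroupTheory.
Variable G : Grp.
Implicit Types (x y z : G) (K H N S : G -> Prop).

Lemma gmulA x y z : x ** (y ** z) = x ** y ** z. Proof. exact: gmul_assoc. Qed.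
Lemma gmul1 x : one ** x = x. Proof. exact: gmul_1l. Qed.
Lemma gmulVg x : x^v ** x = one. Proof. exact: gmul_Vl. Qed.

Lemma gmulgV x : x ** x^v = one.
Proof.
rewrite -[x ** _]gmul1 -{1}(gmulVg x^v) -!gmulA (gmulA x^v x) gmulVg gmul1.
exact: gmulVg.
Qed.

Lemma gmulg1 x : x ** one = x.
Proof. by rewrite -(gmulVg x) gmulA gmulgV gmul1. Qed.

Lemma gmulgK x y : x ** y ** y^v = x.
Proof. by rewrite -gmulA gmulgV gmulg1. Qed.

Lemma gmulgKV x y : x ** y^v ** y = x.
Proof. by rewrite -gmulA gmulVg gmulg1. Qed.

Lemma gmulgI z x y : z ** x = z ** y -> x = y.
Proof. by move=> e; rewrite -(gmul1 x) -(gmulVg z) -gmulA e gmulA gmulVg gmul1. Qed.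

Lemma ginvK x : x^v^v = x.
Proof. by apply: (@gmulgI x^v); rewrite gmulgV gmulVg. Qed.

Lemma ginvM x y : (x ** y)^v = y^v ** x^v.
Proof. by apply: (@gmulgI (x ** y)); rewrite gmulgV gmulA gmulgK gmulgV. Qed.

Lemma ginv1 : (one : G)^v = one.
Proof. by apply: (@gmulgI one); rewrite gmulgV gmul1. Qed.

Definition gE := (gmulA, ginvM, ginvK, gmulgK, gmulgKV, gmulgV, gmulVg, gmul1,
  gmulg1, ginv1).

Lemma powS x n : pow G x n.+1 = x ** pow G x n. Proof. by []. Qed.

Lemma powD x m n : pow G x (m + n) = pow G x m ** pow G x n.
Proof.
by elim: m => [|m IH]; rewrite ?addSn ?powS /= ?gmul1 // IH gmulA.
Qed.

Lemma powSr x n : pow G x n.+1 = pow G x n ** x.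
Proof. by rewrite -addn1 powD /= gmulg1. Qed.

Lemma powM x m n : pow G x (m * n) = pow G (pow G x m) n.
Proof. by elim: n => [|n IH]; rewrite ?muln0 // mulnS powD IH. Qed.

Lemma pow_conj g x n : pow G (g^v ** x ** g) n = g^v ** pow G x n ** g.
Proof. by elim: n => [|n IH]; rewrite ?powS ?IH /= ?gE. Qed.

Lemma pow_comm x y n : x ** y = y ** x -> x ** pow G y n = pow G y n ** x.
Proof.
by move=> e; elim: n => [|n IH] /=; rewrite ?gE // e -gmulA IH gmulA.
Qed.

Lemma gen_sub S x : S x -> gen G S x. Proof. by move=> Sx K _; apply. Qed.

Lemma gen_subgroup S : is_subgroup G (gen G S).
Proof.
split; first by move=> K [K1 _].
split=> [x y gx gy|x gx] K sK SK; case: (sK) => _ [KM KV].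
  by apply: KM; [apply: gx|apply: gy].
by apply: KV; apply: gx.
Qed.

Lemma gen_mono S T x : (forall y, S y -> T y) -> gen G S x -> gen G T x.
Proof.
by move=> ST gx; apply: gx => [|y /ST]; [exact: gen_subgroup|exact: gen_sub].
Qed.

Lemma subg1 K : is_subgroup G K -> K one. Proof. by case. Qed.
Lemma subgM K x y : is_subgroup G K -> K x -> K y -> K (x ** y).
Proof. by case=> _ [KM _]; apply: KM. Qed.
Lemma subgV K x : is_subgroup G K -> K x -> K x^v.
Proof. by case=> _ [_]; apply. Qed.
Lemma subgX K x n : is_subgroup G K -> K x -> K (pow G x n).
Proof. by move=> sK Kx; elim: n => [|n IH]; [exact: subg1|exact: subgM]. Qed.

Lemma subgMl K x y : is_subgroup G K -> K x -> K (x ** y) -> K y.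
Proof.
by move=> sK Kx Kxy; move: (subgM sK (subgV sK Kx) Kxy); rewrite !gE.
Qed.

Lemma subgMr K x y : is_subgroup G K -> K y -> K (x ** y) -> K x.
Proof.
by move=> sK Kx Kxy; move: (subgM sK Kxy (subgV sK Kx)); rewrite !gE.
Qed.

Lemma normal_sub K : is_normal G K -> is_subgroup G K. Proof. by case. Qed.

Lemma normalJ K g x : is_normal G K -> K x -> K (g ** x ** g^v).
Proof. by case=> _ KJ Kx; move: (KJ g^v x Kx); rewrite ginvK. Qed.

Lemma normalC K x y : is_normal G K -> K (x ** y) -> K (y ** x).
Proof. by case=> _ KJ /(KJ x); rewrite !gE. Qed.

Lemma gen_normal S : (forall g s, S s -> S (g^v ** s ** g)) ->
  is_normal G (gen G S).
Proof.
move=> SJ; split=> [|g x]; first exact: gen_subgroup.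
move=> gx; apply: (gx (fun y => gen G S (g^v ** y ** g))) => [|s Ss];
  last by apply: gen_sub; exact: SJ.
have sS := gen_subgroup S.
split; first by rewrite !gE; exact: subg1.
split=> [y z gy gz|y gy].
  by move: (subgM sS gy gz); rewrite !gE.
by move: (subgV sS gy); rewrite !gE.
Qed.

Variables (p : nat) (H : G -> Prop).
Local Notation Phi := (frattini_p G p H).

Lemma frattini_normal : is_normal G H -> is_normal G Phi.
Proof.
move=> nH; have [_ HJ] := nH; apply: gen_normal => g s.
move=> [[a [b [Ha [Hb ->]]]]|[a [Ha ->]]]; [left|right].
  exists (g^v ** a ** g), (g^v ** b ** g); split; [|split]; try exact: HJ.
  by rewrite /Defs.comm !gE.
by exists (g^v ** a ** g); rewrite pow_conj; split; first exact: HJ.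
Qed.

(** As h x h^-1 = x [x, h^-1], conjugates of an element of H depend, modulo [Phi], only on the
    conjugator modulo H. *)
Lemma frattini_conj K h x : is_subgroup G H -> is_subgroup G K ->
  (forall y, Phi y -> K y) -> H h -> H x -> K x -> K (h ** x ** h^v).
Proof.
move=> sH sK PK Hh Hx Kx.
have -> : h ** x ** h^v = x ** Defs.comm G x h^v.
  by rewrite /Defs.comm !gE.
apply: subgM => //; apply/PK; apply: gen_sub; left.
by by exists x, h^v; split=> //; split=> //; apply: subgV.
Qed.

End GroupTheory.

(** The products telescope, so the [g] satisfying the conclusion for all [x] form a subgroup
    containing S. The map [sigma] is arbitrary; it may move [one]. *)
Lemma schreier (G : Grp) (S K : G -> Prop) (sigma : G -> G) :
  is_subgroup G K ->
  (forall x s, S s -> K (sigma x ** s ** (sigma (x ** s))^v)) ->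
  forall g, gen G S g -> forall x, K (sigma x ** g ** (sigma (x ** g))^v).
Proof.
move=> sK KS g gg.
apply: (gg (fun g => forall x, K (sigma x ** g ** (sigma (x ** g))^v)));
  last by move=> s Ss x; apply: KS.
split; first by move=> x; rewrite !gE; exact: subg1.
split=> [a b Ka Kb x|a Ka x].
  by move: (subgM sK (Ka x) (Kb (x ** a))); rewrite !gE.
by move: (subgV sK (Ka (x ** a^v))); rewrite !gE.
Qed.

(** * Subgroups of finite index *)

Section Index.
Variables (G : Grp) (H : G -> Prop).
Hypothesis nH : is_normal G H.
Let sH := normal_sub nH.

Lemma has_index_card (X : finType) (A : {set X}) (f : G -> X) :
  (forall x y, f x = f y <-> H (x^v ** y)) -> (forall x, f x \in A) ->
  (forall a, a \in A -> exists x, f x = a) -> has_index G H #|A|.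
Proof.
move=> fE fA fS.
have /choice[r rP] (i : nat) : exists x, forall ltiA : i < #|A|,
    f x = enum_val (Ordinal ltiA).
  have [lti|gti] := pselect (i < #|A|); last by exists one => lti; case: (gti lti).
  have [x fx] := fS _ (enum_valP (Ordinal lti)).
  by exists x => lti'; rewrite fx; congr enum_val; apply: val_inj.
exists r => x; pose i := enum_rank_in (fA x) (f x).
exists i; split; first exact/ltP/ltn_ord.
have rE : f (r i) = f x.
  rewrite (rP _ (ltn_ord i)) -[RHS](enum_rankK_in (fA x) (fA x)).
  by congr enum_val; apply: val_inj.
split; first exact/fE.
move=> j /ltP ltj /fE; rewrite (rP _ ltj) -rE (rP _ (ltn_ord i)).
by move=> /enum_val_inj [].
Qed.

Lemma has_index_ord n : has_index G H n ->
  exists (idx : G -> 'I_n) (r : 'I_n -> G),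
    (forall x y, idx x = idx y <-> H (x^v ** y)) /\ forall i, idx (r i) = i.
Proof.
case=> r rP.
have /choice[idx idxP] x : exists i : 'I_n, H ((r i)^v ** x) /\
    forall j : 'I_n, H ((r j)^v ** x) -> j = i.
  have [i [/ltP lti [Hi Hj]]] := rP x.
  exists (Ordinal lti); split=> // j /Hj; move/(_ (ltP (ltn_ord j))) => e.
  exact: val_inj.
exists idx, (fun i : 'I_n => r i); split=> [x y|i]; last first.
  by rewrite -((idxP (r i)).2 i) // gmulVg; exact: subg1.
split=> [e|Hxy].
  have := subgM sH (subgV sH (idxP x).1) (idxP y).1.
  by rewrite e !gE.
apply/(idxP y).2; move: (subgM sH (idxP x).1 Hxy).
by rewrite !gE.
Qed.

(** Schreier's lemma. The representative [c] of the trivial coset need not be [one]; [schreier] then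
    yields the conjugate of [x] by [c], so [c] joins the list. *)
Lemma has_index_fin_gen n (X : seq G) : has_index G H n ->
  (forall x, gen G (fun y => List.In y X) x) ->
  exists F : seq G, (forall y, List.In y F -> H y) /\
    forall K, is_subgroup G K -> (forall y, List.In y F -> K y) ->
    forall x, H x -> K x.
Proof.
case/has_index_ord=> idx [r [idxE rK]] genX.
pose c := r (idx one).
pose pt i s := r i ** s ** (r (idx (r i ** s)))^v.
have Hpt i s : H (pt i s).
  exact: (normalC nH ((idxE _ _).1 (rK (idx (r i ** s))))).
have Hc : H c by have := (idxE _ _).1 (rK (idx one)) => /(subgV sH); rewrite !gE.
pose F := c :: flatten [seq [seq pt i s | s <- X] | i <- enum 'I_n].
have FP y : List.In y F <-> y = c \/ exists i s, List.In s X /\ y = pt i s.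
  rewrite /F /=; split=> [[->|]|[->|[i [s [Xs ->]]]]]; [by left| |by left|].
    elim: (enum _) => //= i e IH; case/List.in_app_iff => [|/IH]; last by [].
    by case/List.in_map_iff => s [<- Xs]; right; exists i, s.
  right; have: i \in enum 'I_n by rewrite mem_enum.
  elim: (enum _) => //= j e IH; rewrite in_cons => /predU1P[<-|/IH h].
    by apply/List.in_app_iff; left; apply/List.in_map_iff; exists s.
  by apply/List.in_app_iff; right.
exists F; split=> [y /FP[->//|[i [s [_ ->]]]]//|K sK KF x Hx].
have ix y : H y -> idx y = idx one.
  by move=> Hy; symmetry; apply/idxE; rewrite !gE.
have Kc : K c by apply: KF; apply/FP; left.
have Kx : K ((r \o idx) one ** x ** ((r \o idx) (one ** x))^v).
  apply: (schreier sK _ (genX x)) => y s Xs; apply: KF; apply/FP; right.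
  exists (idx y), s; split=> //; rewrite /pt /=; congr (_ ** (r _)^v).
  apply/idxE; move: ((idxE _ _).1 (rK (idx y))) => /(subgV sH).
  by case: nH => _ HJ /(HJ s); rewrite !gE.
move: Kx; rewrite /= gmul1 (ix x Hx) -/c => Kx.
exact: (subgMl sK Kc (subgMr sK (subgV sK Kc) Kx)).
Qed.

End Index.

(** * Quotients *)

Section Quotient.
Variables (T : Type) (e : T -> T -> Prop).
Variables (mul : T -> T -> T) (inv : T -> T) (e1 : T).
Hypotheses (er : forall x, e x x) (es : forall x y, e x y -> e y x)
  (et : forall x y z, e x y -> e y z -> e x z).
Hypotheses (emul : forall x y x' y', e x x' -> e y y' -> e (mul x y) (mul x' y'))
  (einv : forall x y, e x y -> e (inv x) (inv y)).
Hypotheses (eA : forall x y z, e (mul x (mul y z)) (mul (mul x y) z))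
  (e1l : forall x, e (mul e1 x) x) (eVl : forall x, e (mul (inv x) x) e1).

(** The choice is made from the predicate [e x], so extensionality and proof irrelevance give
    related elements the same representative. *)
Definition crepr x : T := sval (cid (ex_intro (e x) x (er x))).

Lemma crepr_rel x : e x (crepr x).
Proof. by rewrite /crepr; case: cid. Qed.

Lemma crepr_eq x y : e x y -> crepr x = crepr y.
Proof.
move=> exy; rewrite /crepr.
have E : e x = e y.
  by apply/funext => z; apply/propext; split; apply: et => //; apply: es.
move: (ex_intro _ _ _) (ex_intro _ _ _); rewrite E => p q.
by rewrite (Prop_irrelevance p q).
Qed.

Definition quot_car := {x : T | crepr x = x}.

Definition cls x : quot_car :=
  exist _ (crepr x) (esym (crepr_eq (crepr_rel x))).

Lemma cls_eqP x y : cls x = cls y <-> e x y.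
Proof.
split=> [[E]|/crepr_eq E]; last exact: eq_exist.
by apply: et (crepr_rel x) _; rewrite E; apply/es/crepr_rel.
Qed.

Lemma cls_sval u : cls (sval u) = u.
Proof. by case: u => x xP; apply: eq_exist. Qed.

Lemma sval_cls x : e (sval (cls x)) x.
Proof. exact/es/crepr_rel. Qed.

Definition quot_mul (u v : quot_car) := cls (mul (sval u) (sval v)).
Definition quot_inv (u : quot_car) := cls (inv (sval u)).

Lemma quot_mulE x y : quot_mul (cls x) (cls y) = cls (mul x y).
Proof. by apply/cls_eqP/emul; apply: sval_cls. Qed.

Lemma quot_invE x : quot_inv (cls x) = cls (inv x).
Proof. by apply/cls_eqP/einv; apply: sval_cls. Qed.

Definition quotient_group : Grp.
Proof.
refine (@Build_Group quot_car quot_mul quot_inv (cls e1) _ _ _).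
- move=> x y z; rewrite -[x]cls_sval -[y]cls_sval -[z]cls_sval !quot_mulE.
  exact/cls_eqP.
- by move=> x; rewrite -[x]cls_sval quot_mulE; apply/cls_eqP.
- by move=> x; rewrite -[x]cls_sval quot_invE quot_mulE; apply/cls_eqP.
Defined.

End Quotient.

Definition is_hom (G K : Grp) (f : G -> K) := forall x y, f (x ** y) = f x ** f y.

Section Hom.
Variables (G K : Grp) (f : G -> K).
Hypothesis fM : is_hom f.

Lemma hom1 : f one = one.
Proof. by apply: (@gmulgI _ (f one)); rewrite -fM !gE. Qed.

Lemma homV x : f x^v = (f x)^v.
Proof. by apply: (@gmulgI _ (f x)); rewrite -fM !gE hom1. Qed.

Lemma homX x n : f (pow G x n) = pow K (f x) n.
Proof. by elim: n => [|n IH] /=; rewrite ?hom1 // fM IH. Qed.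

Lemma hom_comm x y : f (Defs.comm G x y) = Defs.comm K (f x) (f y).
Proof. by rewrite /Defs.comm !fM !homV. Qed.

Lemma hom_preim (S : K -> Prop) : is_subgroup K S ->
  is_subgroup G (fun x => S (f x)).
Proof.
move=> sS; split; first by rewrite hom1; exact: subg1.
split=> [x y Sx Sy|x Sx]; first by rewrite fM; exact: subgM.
by rewrite homV; exact: subgV.
Qed.

Lemma hom_preim_normal (S : K -> Prop) : is_normal K S ->
  is_normal G (fun x => S (f x)).
Proof.
case=> sS SJ; split; first exact: hom_preim.
by move=> g x Sx; rewrite !fM homV; apply: SJ.
Qed.

Lemma hom_img (S : G -> Prop) : is_subgroup G S ->
  is_subgroup K (fun y => exists2 x, S x & f x = y).
Proof.
move=> sS; split; first by exists one; [exact: subg1|exact: hom1].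
split=> [_ _ [x Sx <-] [y Sy <-]|_ [x Sx <-]].
  by exists (x ** y); [exact: subgM|rewrite fM].
by exists x^v; [exact: subgV|rewrite homV].
Qed.

End Hom.

Lemma quotient_exists (G : Grp) (N : G -> Prop) : is_normal G N ->
  exists (Q : Grp) (f : G -> Q), is_hom f /\ (forall y, exists x, f x = y) /\
    forall x, f x = one <-> N x.
Proof.
move=> nN; have [sN NJ] := nN; pose e x y := N (x^v ** y).
have er x : e x x by rewrite /e gmulVg; exact: subg1.
have es x y : e x y -> e y x by move/(subgV sN); rewrite /e !gE.
have et x y z : e x y -> e y z -> e x z.
  by move=> exy eyz; move: (subgM sN exy eyz); rewrite /e !gE.
have emul x y x' y' : e x x' -> e y y' -> e (x ** y) (x' ** y').
  by rewrite /e => /(NJ y) exx eyy; move: (subgM sN exx eyy); rewrite !gE.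
have einv x y : e x y -> e x^v y^v.
  by move=> /es /(normalC nN); rewrite /e ginvK.
have eE x y : x = y -> e x y by move=> ->.
pose Q := quotient_group er es et emul einv (fun x y z => eE _ _ (gmulA x y z))
  (fun x => eE _ _ (gmul1 x)) (fun x => eE _ _ (gmulVg x)).
exists Q, (cls er es et : G -> Q); split; last split.
- by move=> x y; rewrite /= quot_mulE.
- by move=> u; exists (sval u); exact: cls_sval.
- move=> x; split=> [/cls_eqP /es|Nx]; first by rewrite /e ginv1 gmul1.
  by apply/cls_eqP; apply: (es); rewrite /e ginv1 gmul1.
Qed.

(** * The base group *)

Inductive term := Var of nat | Unit | Mul of term & term | Inv of term.

Fixpoint ev (G : Grp) (f : nat -> G) (w : term) : G :=
  match w with
  | Var i => f i
  | Unit => one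
  | Mul x y => ev f x ** ev f y
  | Inv x => (ev f x)^v
  end.

(* Generators a, b, t, s, z_0, ..., z_(k-1), in this order: s commutes with a, b
   and t, and the variables beyond z_(k-1) are trivial. *)
Definition adm (k : nat) (G : Grp) (f : nat -> G) :=
  (forall i, k + 4 <= i -> f i = one) /\
  (forall i, i < 3 -> f 3 ** f i = f i ** f 3).

(* The group with the presentation encoded by [adm]: two words are identified
   when they agree in every group satisfying the relations. *)
Lemma base_group_exists k : exists (G : Grp) (X : nat -> G), adm k X /\
  (forall S, is_subgroup G S -> (forall i, i < k + 4 -> S (X i)) -> forall x, S x) /\
  forall (K : Grp) (f : nat -> K), adm k f ->
    exists F : G -> K, is_hom F /\ forall i, F (X i) = f i.
Proof.
(* Prop is impredicative, so the relation may quantify over all groups; being a congruence is then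
   immediate. *)
pose e x y := forall (K : Grp) (f : nat -> K), adm k f -> ev f x = ev f y.
have er x : e x x by [].
have es x y : e x y -> e y x by move=> E K f af; rewrite E.
have et x y z : e x y -> e y z -> e x z by move=> E E' K f af; rewrite E ?E'.
have emul x y x' y' : e x x' -> e y y' -> e (Mul x y) (Mul x' y').
  by move=> E E' K f af /=; rewrite E ?E'.
have einv x y : e x y -> e (Inv x) (Inv y) by move=> E K f af /=; rewrite E.
have eA x y z : e (Mul x (Mul y z)) (Mul (Mul x y) z).
  by move=> K f af; exact: gmulA.
have e1l x : e (Mul Unit x) x by move=> K f af; exact: gmul1.
have eVl x : e (Mul (Inv x) x) Unit by move=> K f af; exact: gmulVg.
pose G := quotient_group er es et emul einv eA e1l eVl.
pose c : term -> G := cls er es et.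
have cM x y : c x ** c y = c (Mul x y) by exact: quot_mulE.
have cV x : (c x)^v = c (Inv x) by exact: quot_invE.
exists G, (c \o Var); split; last split.
- split=> i lei; first by apply/cls_eqP => K f [f1 _]; exact: f1.
  have E : c (Mul (Var 3) (Var i)) = c (Mul (Var i) (Var 3)).
    by apply/cls_eqP => K f [_ fC]; exact: fC.
  exact: etrans (cM _ _) (etrans E (esym (cM _ _))).
- move=> S sS SX x; have <- : c (sval x) = x by exact: cls_sval.
  elim: (sval x) => [i||u Su v Sv|u Su]; last 2 first.
  + by rewrite -cM; exact: subgM.
  + by rewrite -cV; exact: subgV.
  + have [/SX //|lei] := ltnP i (k + 4).
    have -> : c (Var i) = one by apply/cls_eqP => K f [f1 _]; exact: f1.
    exact: subg1.
  + exact: (subg1 sS).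
- have sc w : e (sval (c w)) w by exact: sval_cls.
  (* Evaluating the chosen representative is multiplicative because related words have equal values
     under [f]. *)
  move=> K f af; exists (fun x : G => ev f (sval x)); split.
    by move=> x y; exact: (sc (Mul (sval x) (sval y)) _ _ af).
  by move=> i; exact: (sc (Var i) _ _ af).
Qed.

(** * The p-gradient of the base group *)

(** For N and [s] inside H, covering H by [modgen] means that [s] generates H/N modulo commutators
    and p-th powers, so d_p(H/N) <= [size s]. *)
Definition modgen (p : nat) (G : Grp) (H N : G -> Prop) (s : seq G) : G -> Prop :=
  gen G (fun y => List.In y s \/ frattini_p G p H y \/ N y).

Lemma card_fibers (A B : finType) (D : {set A}) (f : A -> B) c :
  (forall x, x \in D -> #|[set y in D | f y == f x]| <= c) -> #|D| <= #|B| * c.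
Proof.
move=> fib; rewrite -sum1_card (partition_big f xpredT) //=.
rewrite -sum_nat_const; apply: leq_sum => b _.
case: (pickP [pred x in D | f x == b]) => [x /andP[Dx /eqP fx]|none].
  apply: leq_trans (fib x Dx); rewrite sum1_card fx.
  by apply/eq_leq/eq_card => y; rewrite !inE.
by rewrite big1 // => x; move: (none x) => /= ->.
Qed.

Lemma In_nth (T : Type) (x0 y : T) (s : seq T) :
  List.In y s -> exists2 j, j < size s & nth x0 s j = y.
Proof.
elim: s => //= x s IH [<-|/IH[j ltj <-]]; first by exists 0.
by exists j.+1.
Qed.

Section BaseGroup.
Variables (k : nat) (G : Grp) (X : nat -> G).
Hypothesis admX : adm k X.
Hypothesis genX : forall S, is_subgroup G S -> (forall i, i < k + 4 -> S (X i)) ->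
  forall x, S x.
Hypothesis liftX : forall (K : Grp) (f : nat -> K), adm k f ->
  exists F : G -> K, is_hom F /\ forall i, F (X i) = f i.

Section Cocycle.
Variable V : zmodType.
Local Open Scope ring_scope.

(* The semidirect product of the functions G -> V by G, acting by right
   translations: a homomorphism into it lifting the identity is a cocycle. *)
Definition twist_mul (a b : (G -> V) * G) : (G -> V) * G :=
  (fun x => a.1 x + b.1 (x ** a.2), a.2 ** b.2).
Definition twist_inv (a : (G -> V) * G) : (G -> V) * G :=
  (fun x => - a.1 (x ** a.2^v), a.2^v).

Definition twisted : Grp.
Proof.
refine (@Build_Group ((G -> V) * G) twist_mul twist_inv (fun=> 0, one) _ _ _).
- move=> a b c; rewrite /twist_mul /= gmulA; congr pair.
  by apply/funext => x; rewrite addrA gmulA.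
- case=> a g; rewrite /twist_mul /= gmul1; congr pair.
  by apply/funext => x; rewrite add0r gmulg1.
- case=> a g; rewrite /twist_mul /= gmulVg; congr pair.
  by apply/funext => x; rewrite addNr.
Defined.

(** When the values on a, b, t vanish, commutation with s only asks that the value on s be invariant
    under right translation by a, b, t. *)
Lemma cocycle_exists (c : nat -> G -> V) :
  (forall i x, (k + 4 <= i)%N || (i < 3)%N -> c i x = 0) ->
  (forall i x, (i < 3)%N -> c 3 (x ** X i) = c 3 x) ->
  exists d : G -> G -> V, (forall g h x, d (g ** h) x = d g x + d h (x ** g)) /\
    forall i x, d (X i) x = c i x.
Proof.
move=> c0 c3.
have [|F [FM FX]] := @liftX twisted (fun i => (c i, X i)).
  case: admX => X1 XC; split=> i lti.
    by have -> : c i = fun=> 0 by [apply/funext => x; rewrite c0 ?lti]; rewrite X1.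
  rewrite /= /twist_mul /= XC //; congr pair.
  by apply/funext => x; rewrite c3 // !(c0 i) ?lti ?orbT // addr0 add0r.
have F2 x : (F x).2 = x.
  move: x; apply: genX => [|i _]; last by rewrite FX.
  split; first by rewrite (hom1 FM).
  split=> [x y Fx Fy|x Fx]; first by rewrite FM /= Fx Fy.
  by rewrite (homV FM) /= Fx.
exists (fun g => (F g).1); split=> [g h x|i x]; last by rewrite FX.
by rewrite FM /= F2.
Qed.

End Cocycle.

Local Open Scope ring_scope.

(** Each pair in [D] prescribes a cocycle vanishing on a, b, t; its values at [one] give a
    homomorphism H -> F_p, determined by [s]. Cocycles that agree there differ by a coboundary [T m]
    with [m] in [VL0], so [#|D|] <= [p ^ size s * #|VL0|]. *)
Lemma base_rank p n (H : G -> Prop) (s : seq G) : prime p ->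
  is_normal G H -> has_index G H n -> (forall y, List.In y s -> H y) ->
  (forall x, H x -> modgen p H (fun y => y = one) s x) ->
  (n * k < size s)%N.
Proof.
move=> p_pr nH /(has_index_ord nH)[idx [r [idxE rK]]] sH Hs.
have [sbH HJ] := nH.
pose M := {ffun 'I_n -> 'F_p}.
pose invL (v : M) := `[< forall x i, (i < 3)%N -> v (idx (x ** X i)) = v (idx x) >].
pose VL := [set v : M | invL v].
pose VL0 := [set v in VL | v (idx one) == 0].
pose U := {ffun 'I_k -> M}.
(* Index 3 is s and index 4 + l is z_l; [insub] yields 0 beyond z_(k-1). *)
pose cc (w : M * U) i x : 'F_p :=
  if (i < 3)%N then 0 else if i == 3 then w.1 (idx x) else
  if insub (i - 4)%N is Some l then w.2 l (idx x) else 0.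
have idxMr x y g : idx x = idx y -> idx (x ** g) = idx (y ** g).
  by move/idxE/(HJ g) => h; apply/idxE; rewrite ginvM; rewrite !gE in h *.
have idxMl h x : H h -> idx (h ** x) = idx x.
  move=> Hh; apply/idxE; rewrite !gE.
  by apply: HJ; exact: subgV.
have /choice[d dP] (w : M * U) : exists d : G -> G -> 'F_p, w.1 \in VL ->
    (forall g h x, d (g ** h) x = d g x + d h (x ** g)) /\
    forall i x, d (X i) x = cc w i x.
  have [wL|_] := boolP (w.1 \in VL); last by exists (fun _ _ => 0).
  have [||d dP] := @cocycle_exists 'F_p (cc w); last by exists d.
    move=> i x /orP[lei|lti]; last by rewrite /cc lti.
    have -> : cc w i x = if insub (i - 4)%N is Some l then w.2 l (idx x) else 0.
      by rewrite /cc ifN ?ifN //; lia.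
    by rewrite insubN //; lia.
  by move: wL; rewrite inE => /asboolP wL i x lti; rewrite /cc /= wL.
pose D := [set w : M * U | w.1 \in VL].
(* The values on s and on the z_l of the coboundary of [m]. *)
pose T (m : M) : M * U :=
  ([ffun j => m (idx (r j ** X 3)) - m j],
   [ffun l : 'I_k => [ffun j => m (idx (r j ** X (4 + l))) - m j]]).
pose E (w : M * U) : {ffun 'I_(size s) -> 'F_p} :=
  [ffun j : 'I_(size s) => d w (nth one s j) one].
have dM w g h x : w \in D -> d w (g ** h) x = d w g x + d w h (x ** g).
  by rewrite inE => /dP[dM _].
have dX w i x : w \in D -> d w (X i) x = cc w i x by rewrite inE => /dP[_].
have d1 w x : w \in D -> d w one x = 0.
  move=> wD; move: (dM w one one x wD); rewrite !gE => /eqP.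
  by rewrite -{1}[d w one x]addr0 (inj_eq (addrI _)) => /eqP.
have dV w g x : w \in D -> d w g^v x = - d w g (x ** g^v).
  move=> wD; move: (dM w g^v g x wD); rewrite gmulVg d1 // => /esym/eqP.
  by rewrite addr_eq0 => /eqP.
have dinv w g x y : w \in D -> idx x = idx y -> d w g x = d w g y.
  move=> wD; pose S g := forall x y, idx x = idx y -> d w g x = d w g y.
  suff Sg : S g by exact: Sg.
  move: g => g; apply: (genX (S := S)) => [|i _ {}x {}y xy];
    last by rewrite !dX // /cc xy.
  split; first by move=> {}x {}y _; rewrite !d1.
  split=> [a b Sa Sb {}x {}y xy|a Sa {}x {}y xy].
    by rewrite !dM // (Sa x y) // (Sb _ _ (idxMr x y a xy)).
  by rewrite !dV //; congr (- _); apply/Sa/idxMr.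
have fib w w' : w \in D -> w' \in D -> E w = E w' ->
    exists2 m, m \in VL0 & w' = w - T m.
  move=> wD w'D EE.
  pose f g := d w g one - d w' g one.
  have fM h g : H h -> f (h ** g) = f h + f g.
    move=> Hh; have h1 : idx (one ** h) = idx one.
      by rewrite -[one ** h]gmulg1 gmul1 idxMl.
    by rewrite /f !dM // (dinv w g _ _ wD h1) (dinv w' g _ _ w'D h1) opprD addrACA.
  have f1 : f one = 0 by rewrite /f !d1 // subrr.
  have fV h : H h -> f h^v = - f h.
    move=> Hh; apply/eqP; rewrite -addr_eq0 -fM; last exact: subgV.
    by rewrite gmulVg f1.
  pose K h := H h /\ f h = 0.
  have sK : is_subgroup G K.
    split; first by split; [exact: subg1|].
    split=> [a b [Ha fa] [Hb fb]|a [Ha fa]].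
      by split; [exact: subgM|rewrite fM // fa fb addr0].
    by split; [exact: subgV|rewrite fV // fa oppr0].
  (* On H, [f] is a homomorphism into a group of exponent p that kills [s]. *)
  have fH h : H h -> f h = 0.
    move=> Hh; suff [] : K h by [].
    apply: (Hs h Hh) => // y [sy|[Phiy|->]]; last exact: (subg1 sK).
      split; first exact: sH.
      have [j ltj <-] := In_nth one sy.
      move/ffunP/(_ (Ordinal ltj)): EE; rewrite !ffunE /f => ->.
      exact: subrr.
    apply: Phiy => // z [[a [b [Ha [Hb ->]]]]|[a [Ha ->]]].
      have [Ha' Hb'] := (subgV sbH Ha, subgV sbH Hb).
      split; first by rewrite /Defs.comm; do !apply: subgM.
      rewrite /Defs.comm fM; last exact: subgM.
      by rewrite !fM // !fV // -opprD addNr.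
    split; first exact: subgX.
    have -> q : f (pow G a q) = f a *+ q.
      elim: q => [|q IH]; first by rewrite mulr0n.
      by rewrite powS fM // IH mulrS.
    exact: (mulrn_pchar (pchar_Fp p_pr)).
  (* Being left H-invariant, [f] factors through G/H; its factor [m] has the difference of the two
     cocycles as coboundary. *)
  have [m fm] : exists m : M, forall x, f x = m (idx x).
    exists [ffun j => f (r j)] => x; rewrite ffunE -{1}(gmulgKV x (r (idx x))) fM.
      rewrite fH ?add0r //.
      exact: (normalC nH ((idxE _ _).1 (rK (idx x)))).
    exact: (normalC nH ((idxE _ _).1 (rK (idx x)))).
  have fX i x : f (x ** X i) = f x + (cc w i x - cc w' i x).
    by rewrite /f !dM // !dX // !gE opprD addrACA.
  exists m.
    rewrite !inE -fm f1 eqxx andbT; apply/asboolP => x i lti.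
    by rewrite -!fm fX /cc lti subrr addr0.
  have mX i j : m (idx (r j ** X i)) - m j = cc w i (r j) - cc w' i (r j).
    by rewrite -fm fX fm rK addrAC subrr add0r.
  rewrite [LHS]surjective_pairing [w in RHS]surjective_pairing; congr pair.
    by apply/ffunP => j; rewrite !ffunE mX /cc /= rK opprB addrC subrK.
  apply/ffunP => l; apply/ffunP => j.
  by rewrite !ffunE mX /cc addKn valK /= rK opprB addrC subrK.
have p_gt1 := prime_gt1 p_pr.
have cM : #|M| = (p ^ n)%N by rewrite card_ffun card_Fp // card_ord.
have leD : (#|VL| * (p ^ n) ^ k <= p ^ size s * #|VL0|)%N.
  have -> : (p ^ size s)%N = #|{ffun 'I_(size s) -> 'F_p}|.
    by rewrite card_ffun card_Fp // card_ord.
  have -> : (#|VL| * (p ^ n) ^ k)%N = #|D|.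
    rewrite -cM -[k in LHS]card_ord -card_ffun -cardsT -cardsX.
    by apply: eq_card => w; rewrite !inE andbT.
  apply: (card_fibers (f := E)) => w wD.
  apply: leq_trans (leq_imset_card (fun m => w - T m) (mem VL0)).
  apply: subset_leq_card; apply/fintype.subsetP => w'; rewrite inE => /andP[w'D /eqP EE].
  have [m mV ->] := fib w w' wD w'D (esym EE).
  by apply/imsetP; exists m.
(* Members of [VL0] plus constants lie in [VL], and the constant is read off at [idx one]; this
   factor p makes the final inequality strict. *)
have leL : (p * #|VL0| <= #|VL|)%N.
  rewrite -[X in (X * _ <= _)%N](card_Fp p_pr) -cardsT -cardsX.
  pose g (cm : 'F_p * M) : M := [ffun j => cm.2 j + cm.1].
  rewrite -(card_in_imset (f := g)).
    apply: subset_leq_card; apply/fintype.subsetP => m' /imsetP[[c m] + ->].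
    rewrite !inE /= => /andP[/asboolP mL _].
    by apply/asboolP => x i lti; rewrite !ffunE /= mL.
  move=> [c m] [c' m']; rewrite !inE /= => /andP[_ /eqP m0] /andP[_ /eqP m0'].
  move=> /ffunP E'; have := E' (idx one); rewrite !ffunE /= m0 m0' !add0r => cc'.
  congr pair => //; apply/ffunP => j; have := E' j.
  by rewrite !ffunE /= cc' => /addIr.
have VL0_gt0 : (0 < #|VL0|)%N.
  apply/card_gt0P; exists 0; rewrite !inE !ffunE eqxx andbT.
  by apply/asboolP => x i _; rewrite !ffunE.
have := leq_trans (leq_mul leL (leqnn _)) leD.
by rewrite mulnAC leq_pmul2r // -expnM -expnS leq_exp2l.
Qed.

End BaseGroup.

(** * Adding power relators *)

Definition ncl (G : Grp) (S : G -> Prop) : G -> Prop :=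
  gen G (fun y => exists g r, S r /\ y = g^v ** r ** g).

(* The p-gradient of G/N is at least b, in terms of the subgroups of G. *)
Definition good (p : nat) (G : Grp) (b : R) (N : G -> Prop) :=
  forall (H : G -> Prop) (K : nat) (s : seq G),
    is_normal G H -> has_index G H (p ^ K) -> (forall x, N x -> H x) ->
    (forall y, List.In y s -> H y) -> (forall x, H x -> modgen p H N s x) ->
    (b * INR (p ^ K) <= INR (size s) - 1)%Re.

Section Ncl.
Variables (G : Grp) (S : G -> Prop).

Lemma ncl_normal : is_normal G (ncl S).
Proof.
apply: gen_normal => g _ [h [r [Sr ->]]].
by exists (h ** g), r; rewrite !gE.
Qed.

Lemma ncl_sub x : S x -> ncl S x.
Proof. by move=> Sx; apply: gen_sub; exists one, x; rewrite !gE. Qed.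

Lemma ncl_min K : is_normal G K -> (forall x, S x -> K x) ->
  forall x, ncl S x -> K x.
Proof.
case=> sK KJ SK x nx; apply: nx => // _ [g [r [Sr ->]]].
by apply/KJ/SK.
Qed.

End Ncl.

Section PowerRelator.
Variables (p : nat) (p_pr : prime p) (G : Grp) (H N N' : G -> Prop).
Variables (n : nat) (w : G) (j : nat) (s : seq G).
Let q := (p ^ j)%N.
Hypotheses (nH : is_normal G H) (Hn : has_index G H n) (Hw : H (pow G w q)).
Hypothesis NN' : forall K, is_subgroup G K -> (forall x, N x -> K x) ->
  (forall g, K (g^v ** pow G w q ** g)) -> forall x, N' x -> K x.
Hypotheses (sH : forall y, List.In y s -> H y)
  (Hs : forall x, H x -> modgen p H N' s x).

Lemma pow_gcd d : H (pow G w d) -> H (pow G w (gcdn d q)).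
Proof.
have sbH := normal_sub nH.
case: (posnP d) => [->|d_gt0 Hd]; first by rewrite gcd0n.
have [a _ /dvdnP[c e]] := Bezoutl q d_gt0.
apply: (@subgMr _ _ _ (pow G w (a * q)) sbH).
  by rewrite mulnC powM; apply: subgX.
by rewrite -powD e mulnC powM; apply: subgX.
Qed.

(** By [NN'], a subgroup containing N and the conjugates of w^q absorbs N', so only those conjugates
    need covering. *)
Lemma modgen_extend (s' : seq G) : (forall y, List.In y s -> List.In y s') ->
  (forall g, modgen p H N s' (g^v ** pow G w q ** g)) ->
  forall x, H x -> modgen p H N s' x.
Proof.
move=> ss' gs' x /Hs gx; have sK := gen_subgroup
  (fun y => List.In y s' \/ frattini_p G p H y \/ N y).
apply: gx => // y [/ss' ys|[Py|N'y]]; try by apply: gen_sub; auto.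
by apply: NN' N'y => // z Nz; apply: gen_sub; auto.
Qed.

(* If w has order q modulo H, then modulo [H,H]H^p the conjugates of w^q depend
   only on their class in (G/H)/<w>, which has n/q elements; otherwise w^q is a
   p-th power of an element of H. *)
Lemma power_relator_rank : exists s' : seq G, (forall y, List.In y s' -> H y) /\
  (forall x, H x -> modgen p H N s' x) /\ q * size s' <= q * size s + n.
Proof.
have [sbH HJ] := nH.
have nP := frattini_normal p nH.
case: (pselect (0 < j /\ H (pow G w (p ^ j.-1)))) => [[j_gt0 Hw']|Hw'].
  exists s; do 2!split=> //; last exact: leq_addr.
  apply: modgen_extend => // g; apply: gen_sub; right; left.
  apply: (nP.2); rewrite /q -(prednK j_gt0) expnSr powM.
  by apply: gen_sub; right; exists (pow G w (p ^ j.-1)).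
(* Here w has order exactly q modulo H: a gcd p^i with i < j would put w^(p^(j-1)) in H. *)
have qdiv d : H (pow G w d) -> q %| d.
  move/pow_gcd => Hg; have /(dvdn_pfactor _ _ p_pr)[i lei gE'] := dvdn_gcdr d q.
  have [ij|] := eqVneq i j; first by rewrite /q -ij -gE' dvdn_gcdl.
  move=> neij; have ltij : i < j by rewrite ltn_neqAle neij.
  case: Hw'; split; first by apply: leq_ltn_trans ltij.
  have -> : j.-1 = i + (j.-1 - i) by lia.
  by rewrite expnD powM; apply: subgX => //; rewrite -gE'.
have [idx [r [idxE rK]]] := has_index_ord nH Hn.
have idxMr x y g : idx x = idx y -> idx (x ** g) = idx (y ** g).
  by move/idxE/(HJ g) => h; apply/idxE; rewrite ginvM; rewrite !gE in h *.
have sigma_inj : injective (fun i => idx (r i ** w)).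
  by move=> i i' /(idxMr _ _ w^v); rewrite !gE !rK.
(* Right multiplication by w on G/H. Its orbits are the cosets x<w>, of size at least q by
   [qdiv]. *)
pose sigma := perm sigma_inj.
have sigmaX e i : (sigma ^+ e)%g i = idx (r i ** pow G w e).
  elim: e => [|e IH]; first by rewrite expg0 perm1 gmulg1 rK.
  rewrite expgSr permM IH permE powSr gmulA.
  by apply: idxMr; rewrite rK.
have orb i : q <= #|porbit sigma i|.
  apply: dvdn_leq; first by rewrite lt0n card_porbit_neq0.
  apply: qdiv; have := iter_porbit sigma i; rewrite -permX sigmaX => e.
  have : idx (r i) = idx (r i ** pow G w #|porbit sigma i|) by rewrite rK.
  by move/idxE; rewrite !gE.
pose cj (A : {set 'I_n}) :=
  if [pick i in A] is Some i then r i ** pow G w q ** (r i)^v else one.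
exists (s ++ [seq cj A | A <- enum (porbits sigma)]); split; [|split].
- move=> y /List.in_app_iff[/sH //|/List.in_map_iff[A [<- _]]].
  rewrite /cj; case: pickP => [i _|_]; last exact: subg1.
  exact: normalJ.
- apply: modgen_extend => [y sy|g]; first by apply/List.in_app_iff; left.
  set K := modgen p H N _; rewrite -{2}[g]ginvK.
  have sK : is_subgroup G K by exact: gen_subgroup.
  have Kidx y z : idx y = idx z -> K (y ** pow G w q ** y^v) ->
      K (z ** pow G w q ** z^v).
    move=> /idxE /(normalJ y nH); set h := (X in H X) => Hh Ky.
    have -> : z ** pow G w q ** z^v = h ** (y ** pow G w q ** y^v) ** h^v.
      by rewrite /h !gE.
    apply: (@frattini_conj G p H K) => //; last exact: normalJ.
    by move=> x Px; apply: gen_sub; right; left.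
  pose i := idx g^v.
  have [i0 [i0A cjE]] : exists i0, i0 \in porbit sigma i /\
      cj (porbit sigma i) = r i0 ** pow G w q ** (r i0)^v.
    rewrite /cj; case: pickP => [i0 i0A|none]; first by exists i0.
    by move: (none i); rewrite porbit_id.
  have [e i0E] := porbitP _ _ _ i0A.
  apply: (Kidx (r i)); first by rewrite rK.
  have Kz : K ((r i ** pow G w e) ** pow G w q ** (r i ** pow G w e)^v).
    apply: (Kidx (r i0)); first by rewrite rK i0E sigmaX.
    rewrite -cjE; apply: gen_sub; left; apply/List.in_app_iff; right.
    apply/List.in_map_iff; exists (porbit sigma i); split=> //.
    have : porbit sigma i \in enum (porbits sigma) by rewrite mem_enum imset_f.
    elim: (enum _) => //= A l IH; rewrite in_cons => /predU1P[->|/IH]; by [left|right].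
  (* Powers of w commute, so moving the conjugator along an orbit does not change the conjugate of
     w^q. *)
  have wC : pow G w e ** pow G w q = pow G w q ** pow G w e.
    by rewrite -!powD addnC.
  by move: Kz; rewrite ginvM -(gmulA (r i)) wC !gE.
- rewrite size_cat size_map -cardE mulnDr leq_add2l.
  have nE : n = \sum_(A in porbits sigma) #|A|.
    rewrite -[LHS]card_ord -sum1_card.
    rewrite (partition_big (porbit sigma) (mem (porbits sigma))) /=.
      apply: eq_bigr => A /imsetP[x _ ->]; rewrite sum1_card.
      by apply: eq_card => y; rewrite -eq_porbit_mem.
    by move=> i _; apply: imset_f.
  rewrite [leqRHS]nE mulnC -sum_nat_const; apply: leq_sum => A /imsetP[x _ ->].
  exact: orb.
Qed.

End PowerRelator.

(** * Sets of relators and their chains *)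

Section Rels.
Variables (p : nat) (p_pr : prime p) (G : Grp) (I : Type) (rel : I -> G).

Definition rels (E : set I) : G -> Prop := fun y => exists2 i, E i & y = rel i.

Lemma rels_mono (E E' : set I) x : subset E E' ->
  ncl (rels E) x -> ncl (rels E') x.
Proof.
move=> EE'; apply: ncl_min; first exact: ncl_normal.
by move=> y [i Ei ->]; apply: ncl_sub; exists i => //; apply: EE'.
Qed.

(** By [power_relator_rank], dropping the new relator costs at most n/q further generators in index
    n, that is 1/q after division by n. *)
Lemma good_power (b b' : R) (E : set I) i w j : rel i = pow G w (p ^ j) ->
  (b' <= b - / INR (p ^ j))%Re -> good p b (ncl (rels E)) ->
  good p b' (ncl (rels (setU E (set1 i)))).
Proof.
move=> ri lebb' gE' H K s nH HK NH sH Hs.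
have [|K' sK' K'N K'w|s' [s'H [Hs' les']]] :=
    @power_relator_rank p p_pr G H (ncl (rels E)) (ncl (rels (setU E (set1 i))))
      (p ^ K) w j s nH HK _ _ sH Hs.
- by rewrite -ri; apply: NH; apply: ncl_sub; exists i => //; exact: or_intror.
- move=> x nx; apply: nx => // _ [g [_ [[i' iE ->] ->]]].
  case: (iE : E i' \/ i' = i) => [Ei'|->].
    by apply: K'N; apply: gen_sub; exists g, (rel i'); split=> //; exists i'.
  by rewrite ri.
have NH' x : ncl (rels E) x -> H x.
  by move=> Nx; apply: NH; apply: rels_mono Nx => y; exact: or_introl.
have := gE' H K s' nH HK NH' s'H Hs'.
have q_gt0 : (0 < INR (p ^ j))%Re.
  by apply: lt_0_INR; apply/ltP; rewrite expn_gt0 prime_gt0.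
have n_gt0 : (0 < INR (p ^ K))%Re.
  by apply: lt_0_INR; apply/ltP; rewrite expn_gt0 prime_gt0.
have : (INR (p ^ j) * INR (size s') <= INR (p ^ j) * INR (size s) + INR (p ^ K))%Re.
  by rewrite -!mult_INR -plus_INR; apply: le_INR; apply/leP.
move: (INR (p ^ j)) (INR (p ^ K)) (INR (size s)) (INR (size s')) q_gt0 n_gt0 lebb'.
move=> q n x x' q_gt0 n_gt0 lebb' h1 h2.
have h3 : (x' <= x + / q * n)%Re.
  apply: (Rmult_le_reg_l q) => //; field_simplify; lra.
have : (b' * n <= (b - / q) * n)%Re by apply: Rmult_le_compat_r; lra.
lra.
Qed.

(** Compactness: H is finitely generated, so generation modulo the union involves finitely many
    relators, all in one member of the chain. *)
Lemma good_bigcup (X : seq G) (b : R) (F : set (set I)) (E0 : set I) :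
  (forall x, gen G (fun y => List.In y X) x) -> F E0 ->
  (forall E, F E -> good p b (ncl (rels E))) -> total_on F (@subset I) ->
  good p b (ncl (rels (bigcup F (fun E => E)))).
Proof.
move=> genX FE0 Fg Ftot H K s nH HK NH sH Hs.
set U := bigcup _ _ in NH Hs.
have EU E : F E -> subset E U by move=> FE x Ex; exists E.
have Nmono E E' x : subset E E' -> modgen p H (ncl (rels E)) s x ->
    modgen p H (ncl (rels E')) s x.
  by move=> EE'; apply: gen_mono => y [|[|/(rels_mono EE')]]; auto.
have ex x : modgen p H (ncl (rels U)) s x ->
    exists2 E, F E & modgen p H (ncl (rels E)) s x.
  have sN E : is_subgroup G (modgen p H (ncl (rels E)) s) by exact: gen_subgroup.
  have comp E E' : F E -> F E' -> exists2 E'', F E'' & subset E E'' /\ subset E' E''.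
    by move=> FE FE'; case: (Ftot E E' FE FE') => h; [exists E'|exists E] => //; split=> // x.
  (* Totality of the chain makes this union of subgroups a subgroup. *)
  have sub1 : is_subgroup G (fun x => exists2 E, F E & modgen p H (ncl (rels E)) s x).
    split; first by exists E0 => //; exact: (subg1 (sN E0)).
    split=> [y z [E FE Ey] [E' FE' Ez]|y [E FE Ey]]; last first.
      by exists E => //; exact: (subgV (sN E)).
    have [E'' FE'' [l l']] := comp E E' FE FE'; exists E'' => //.
    by apply: (subgM (sN E'')); [exact: Nmono Ey|exact: Nmono Ez].
  move=> gx; apply: (gx _ sub1) => y [sy|[Py|Ny]]; try by exists E0 => //; apply: gen_sub; auto.
  apply: (Ny _ sub1) => _ [g [_ [[i [E FE Ei] ->] ->]]]; exists E => //.
  apply: gen_sub; right; right; apply: gen_sub.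
  by exists g, (rel i); split=> //; exists i.
have [L [LH LP]] := has_index_fin_gen nH HK genX.
have [E FE LE] : exists2 E, F E &
    forall y, List.In y L -> modgen p H (ncl (rels E)) s y.
  have : forall y, List.In y L -> modgen p H (ncl (rels U)) s y.
    by move=> y /LH; apply: Hs.
  elim: L {LH LP} => [|y L IH] LU; first by exists E0.
  have [E FE EL] : exists2 E, F E &
      forall y, List.In y L -> modgen p H (ncl (rels E)) s y.
    by apply: IH => z Lz; apply: LU; right.
  have [E' FE' Ey] := ex y (LU y (or_introl erefl)).
  have [l|l] := Ftot E E' FE FE'.
    by exists E' => // z [<- //|/EL]; apply: Nmono.
  by exists E => // z [<-|/EL //]; apply: Nmono Ey.
apply: (Fg E FE H K s nH HK) => // [x Nx|x Hx].
  by apply: NH; apply: rels_mono Nx; exact: EU.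
by apply: LP => //; exact: gen_subgroup.
Qed.

End Rels.

(** * A finite p-group with many independent commutators *)

Section Tower.
Variables (p e j : nat) (p_pr : prime p) (e_gt0 : 0 < e) (j_gt0 : 0 < j).
Let m := (p ^ e)%N.
Let q := (p ^ j)%N.
Local Open Scope ring_scope.
Local Notation Om := ('Z_m * ('Z_q * 'Z_q))%type.
Implicit Types (k : 'Z_m) (f : 'Z_m -> 'Z_q) (h : 'Z_m -> 'Z_q -> 'Z_q) (x : Om).

Lemma m_gt1 : (1 < m)%N. Proof. by rewrite -{1}(exp1n e) ltn_exp2r // prime_gt1. Qed.
Lemma q_gt1 : (1 < q)%N. Proof. by rewrite -{1}(exp1n j) ltn_exp2r // prime_gt1. Qed.

Lemma Zp_mulrn_self n (z : 'Z_n) : (1 < n)%N -> z *+ n = 0.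
Proof. by move=> n_gt1; rewrite -mulr_natr pchar_Zp // mulr0. Qed.

(** Triangular maps: each coordinate is shifted by an amount depending on the earlier ones. They
    form an iterated wreath product of Z_q, Z_q and Z_m. *)
Definition tw k f h x : Om := (x.1 + k, (x.2.1 + f x.1, x.2.2 + h x.1 x.2.1)).

Lemma tw_inj k f h : injective (tw k f h).
Proof.
case=> i [l v] [i' [l' v']]; rewrite /tw /= => /pair_equal_spec[ei].
by move: (addIr _ ei) => <- /pair_equal_spec[/addIr <- /addIr <-].
Qed.

Definition tp k f h : {perm Om} := perm (@tw_inj k f h).

Lemma tpE k f h x : tp k f h x = tw k f h x. Proof. exact: permE. Qed.

Lemma tp_ext k f h f' h' : f =1 f' -> h =2 h' -> tp k f h = tp k f' h'.
Proof. by move=> ff' hh'; apply/permP => x; rewrite !tpE /tw ff' hh'. Qed.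

Lemma tpM k f h k' f' h' : (tp k f h * tp k' f' h')%g =
  tp (k + k') (fun i => f i + f' (i + k)) (fun i l => h i l + h' (i + k) (l + f i)).
Proof. by apply/permP => x; rewrite permM !tpE /tw /= !addrA. Qed.

Lemma tp1 : tp 0 (fun=> 0) (fun _ _ => 0) = 1%g.
Proof. by apply/permP => -[i [l v]]; rewrite tpE perm1 /tw /= !addr0. Qed.

Lemma tpV k f h : ((tp k f h)^-1)%g =
  tp (- k) (fun i => - f (i - k)) (fun i l => - h (i - k) (l - f (i - k))).
Proof.
apply/eqP; rewrite eq_invg_mul tpM -tp1 subrr; apply/eqP.
by apply: tp_ext => [i|i l]; rewrite ?addrK subrr.
Qed.

Lemma tpX0 f h n : exists h', (tp 0 f h ^+ n)%g = tp 0 (fun i => f i *+ n) h'.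
Proof.
elim: n => [|n [h' IH]]; first by exists (fun _ _ => 0); rewrite expg0 -tp1.
rewrite expgS IH tpM addr0; eexists; apply: tp_ext => [i|i l]; last by [].
by rewrite addr0 mulrS.
Qed.

Lemma tpX00 h n : (tp 0 (fun=> 0) h ^+ n)%g = tp 0 (fun=> 0) (fun i l => h i l *+ n).
Proof.
elim: n => [|n IH]; first by rewrite expg0 -tp1.
by rewrite expgS IH tpM addr0; apply: tp_ext => [i|i l]; rewrite !addr0 ?mulrS.
Qed.

Lemma tpX k f h n : exists f' h', (tp k f h ^+ n)%g = tp (k *+ n) f' h'.
Proof.
elim: n => [|n [f' [h' IH]]].
  by exists (fun=> 0), (fun _ _ => 0); rewrite expg0 mulr0n tp1.
by rewrite expgS IH tpM mulrS; do 2!eexists.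
Qed.

Definition is_tp (g : {perm Om}) := exists k f h, g = tp k f h.

Lemma is_tp1 : is_tp 1%g.
Proof. by rewrite -tp1; do 3!eexists. Qed.

(** The m-th power fixes the first coordinate, its q-th power also the second, and a further q-th
    power the third. *)
Lemma is_tp_expg g : is_tp g -> (g ^+ (m * q * q))%g = 1%g.
Proof.
move=> [k [f [h ->]]]; rewrite !expgM.
have [f1 [h1 ->]] := tpX k f h m; rewrite Zp_mulrn_self ?m_gt1 //.
have [h2 ->] := tpX0 f1 h1 q.
have -> : tp 0 (fun i => f1 i *+ q) h2 = tp 0 (fun=> 0) h2.
  by apply: tp_ext => // i; rewrite Zp_mulrn_self ?q_gt1.
rewrite tpX00 -tp1; apply: tp_ext => // i l.
by rewrite Zp_mulrn_self ?q_gt1.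
Qed.

Lemma tp_group_card (P : {group {perm Om}}) : (forall g, g \in P -> is_tp g) ->
  exists K, #|P| = (p ^ K)%N.
Proof.
move=> Ptp; suff /p_natP[K KP] : (p.-nat #|P|)%N by exists K.
apply/(@pgroupP _ p P) => r r_pr rP.
have [x xP xr] := Cauchy r_pr rP.
have: (r %| m * q * q)%N by rewrite -xr order_dvdn is_tp_expg //; exact: Ptp.
rewrite -!expnD Euclid_dvdX // => /andP[+ _].
by rewrite (dvdn_prime2 r_pr p_pr) => /eqP->; rewrite inE.
Qed.

Variable chi : 'Z_m -> bool.

(** [pt], [pa], [pb], [pc i] are the images of t, a, b, c_i. [chi] marks the positions of Z_m at
    which c_i is to survive. *)
Definition pt : {perm Om} := tp 1 (fun=> 0) (fun _ _ => 0).
Definition pa : {perm Om} := tp 0 (fun i => (chi i)%:R) (fun _ _ => 0).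
Definition pb : {perm Om} :=
  tp 0 (fun=> 0) (fun i l => ((i == 0) && (l == 0))%:R).
Definition pc (i : nat) : {perm Om} := tp 0 (fun=> 0)
  (fun i' l => if i' == i%:R then (l == 0)%:R - (l == (chi i')%:R)%:R else 0).

Lemma pt_expg i : (pt ^+ i)%g = tp i%:R (fun=> 0) (fun _ _ => 0).
Proof.
elim: i => [|i IH]; first by rewrite expg0 -tp1.
by rewrite expgS IH tpM mulrS; apply: tp_ext => [k|k l]; rewrite addr0.
Qed.

(** Conjugation by [pt ^+ i] moves the support of [pb] to position i; commutation with [pa] leaves a
    difference of two indicators, one displaced by [chi]. *)
Lemma pc_comm i : pc i =
  (pa^-1 * ((pt ^+ i)^-1 * pb * pt ^+ i)^-1 * (pa * ((pt ^+ i)^-1 * pb * pt ^+ i)))%g.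
Proof.
have -> : ((pt ^+ i)^-1 * pb * pt ^+ i)%g =
    tp 0 (fun=> 0) (fun i' l => ((i' == i%:R) && (l == 0))%:R).
  rewrite pt_expg tpV !tpM !addr0 addNr; apply: tp_ext => [k|k l].
    by rewrite oppr0.
  by rewrite oppr0 !addr0 add0r subr_eq0.
rewrite /pa !tpV !tpM oppr0 !addr0; apply: tp_ext => [k|k l].
  by rewrite oppr0 !addr0 addNr.
rewrite oppr0 !addr0 !add0r subrK subr_eq0.
by case: eqP => _ /=; rewrite ?oppr0 ?addr0 // addrC.
Qed.

Lemma pc_trivial i : ~~ chi i%:R -> pc i = 1%g.
Proof.
move=> ci; rewrite -tp1; apply: tp_ext => // k l.
by case: eqP => // ->; rewrite (negPf ci) subrr.
Qed.

Lemma pc_expg i : (pc i ^+ q)%g = 1%g.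
Proof.
by rewrite tpX00 -tp1; apply: tp_ext => // k l; rewrite Zp_mulrn_self ?q_gt1.
Qed.

(** At a marked i, right multiplication by c_i lowers [kap i] by 1 and fixes [kap i'] at other
    positions. The inverse makes c_i act first, on the base point, where its effect is known. *)
Definition kap (i : nat) (g : {perm Om}) : 'Z_q := ((g^-1)%g (i%:R, (0, 0))).2.2.

Lemma kap_pc i g n : is_tp g -> chi i%:R ->
  kap i (g * pc i ^+ n)%g = kap i g - n%:R.
Proof.
move=> [k [f [h ->]]] ci; rewrite /kap invMg permM tpX00 !tpV tpE /tw /=.
rewrite !tpE /tw /= !(oppr0, addr0, subr0) !eqxx ci eq_sym oner_eq0 subr0 !add0r.
by rewrite addrC.
Qed.

Lemma kap_pc_neq i i' g n : i%:R != i'%:R :> 'Z_m ->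
  kap i' (g * pc i ^+ n)%g = kap i' g.
Proof.
move=> ii'; rewrite /kap invMg permM tpX00 !tpV tpE /tw /=.
by rewrite !(oppr0, addr0, subr0) eq_sym (negPf ii') mul0rn oppr0 addr0.
Qed.

Definition nonzero_kap (P : {group {perm Om}}) (S : seq nat) : {set {perm Om}} :=
  [set g in P | all (fun i => kap i g != 0) S].

(** Right multiplication by c_i cycles [kap i] through Z_q and fixes the other coordinates, so each
    site keeps at most the fraction 1 - 1/q. *)
Lemma card_nonzero_kap (P : {group {perm Om}}) (S : seq nat) :
  (forall g, g \in P -> is_tp g) -> (forall i, pc i \in P) ->
  uniq [seq i%:R : 'Z_m | i <- S] -> (forall i, i \in S -> chi i%:R) ->
  (q ^ size S * #|nonzero_kap P S| <= q.-1 ^ size S * #|P|)%N.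
Proof.
move=> Ptp Pc; elim: S => [|i S IH] /= => [_ _|/andP[iS Su] cS].
  rewrite !expn0 !mul1n; apply: subset_leq_card; apply/fintype.subsetP => g.
  by rewrite inE => /andP[].
have {}IH : (q ^ size S * #|nonzero_kap P S| <= q.-1 ^ size S * #|P|)%N.
  by apply: IH => // i' i'S; apply: cS; rewrite in_cons i'S orbT.
pose A := nonzero_kap P S; pose Z := [set g in A | kap i g == 0].
have AE : nonzero_kap P (i :: S) = A :\: Z.
  apply/finset.setP => g; rewrite !inE /=.
  by case: (g \in P); case: (all _ S); case: (kap i g == 0).
have ZA : Z \subset A by apply/fintype.subsetP => g; rewrite inE => /andP[].
(* Multiplication by [pc i ^+ kap i g] injects the fibre of [kap i] through [g] into the fibre [Z]
   over 0. *)
have leA : (#|A| <= q * #|Z|)%N.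
  have qE : #|'Z_q| = q by rewrite card_ord Zp_cast ?q_gt1.
  rewrite -[X in (X * _)%N]qE.
  apply: (card_fibers (f := kap i)) => g gA.
  rewrite -(card_imset _ (mulIg (pc i ^+ (kap i g))%g)).
  apply: subset_leq_card; apply/fintype.subsetP => x /imsetP[y + ->].
  rewrite !inE => /andP[/andP[yP yS] /eqP yg].
  have ci : chi i%:R by apply: cS; rewrite mem_head.
  have ytp := Ptp y yP.
  rewrite groupM ?groupX //= kap_pc // yg natr_Zp subrr eqxx andbT.
  apply/allP => i' i'S; rewrite kap_pc_neq ?(allP yS) //.
  by apply: contra iS => /eqP->; apply: map_f.
have q_gt0 : (0 < q)%N by apply: ltnW q_gt1.
have leq1 : (q * #|nonzero_kap P (i :: S)| <= q.-1 * #|A|)%N.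
  rewrite AE cardsD (finset.setIidPr ZA) mulnBr -subn1 mulnBl mul1n.
  by apply: leq_sub2l.
rewrite !expnS -mulnA [(_ ^ _ * _)%N]mulnC mulnA.
apply: leq_trans (leq_mul leq1 (leqnn _)) _.
by rewrite -!mulnA leq_mul2l mulnC IH orbT.
Qed.

End Tower.

(** * Quotients of the base group with small p-gradient *)

Definition fin_grp (gT : finGroupType) : Grp :=
  @Build_Group gT (fun x y => x * y)%g (fun x => x^-1)%g 1%g
    (@mulgA gT) (@mul1g gT) (@mulVg gT).

Lemma fin_grp_pow (gT : finGroupType) (x : fin_grp gT) n :
  pow (fin_grp gT) x n = (x ^+ n)%g.
Proof. by elim: n => [|n IH]; rewrite ?expg0 // expgS powS IH. Qed.

Lemma InP (T : eqType) (x : T) s : List.In x s <-> x \in s.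
Proof.
elim: s => //= y s IH; rewrite in_cons; split.
  by case=> [->|/IH ->]; rewrite ?eqxx ?orbT.
by case/predU1P=> [->|/IH]; [left|right].
Qed.

Section Collapse.
Variables (k : nat) (G : Grp) (X : nat -> G).
Hypothesis admX : adm k X.
Hypothesis genX : forall S, is_subgroup G S -> (forall i, i < k + 4 -> S (X i)) ->
  forall x, S x.
Hypothesis liftX : forall (K : Grp) (f : nat -> K), adm k f ->
  exists F : G -> K, is_hom F /\ forall i, F (X i) = f i.

Definition site (i : nat) : G :=
  Defs.comm G (X 0) ((pow G (X 2) i)^v ** X 1 ** pow G (X 2) i).

(* logn p takes every value infinitely often, and logn p i only depends on i
   modulo p^e when p^e does not divide i. *)
Definition prel (p : nat) (li : nat * nat) : G :=
  pow G (X (4 + li.1) ** site li.2) (p ^ logn p li.2).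

Variables (p : nat) (p_pr : prime p) (e j : nat) (j_gt0 : 0 < j) (ltje : j < e).
Variables (S : seq nat) (N : G -> Prop).
Let m := (p ^ e)%N.
Let q := (p ^ j)%N.
Hypotheses (uS : uniq S) (Sm : forall i, i \in S -> i < m)
  (Sj : forall i, i \in S -> logn p i = j).
Hypotheses (nN : is_normal G N) (relN : forall l i, i \in S -> N (prel p (l, i)))
  (Nrel : forall x, N x -> ncl (fun y => exists li, y = prel p li) x).

Let e_gt0 : 0 < e. Proof. exact: leq_ltn_trans ltje. Qed.
Let m_gt1' : 1 < m := m_gt1 p_pr e_gt0.
Let q_gt1' : 1 < q := q_gt1 p_pr j_gt0.

Local Notation Om := ('Z_m * ('Z_q * 'Z_q))%type.
Local Notation E := ({perm Om} * 'Z_m)%type.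

Definition in_sites (z : 'Z_m) := (z : nat) \in S.
Local Notation pcS := (@pc p e j in_sites).

Lemma val_natr (i : nat) : ((i%:R : 'Z_m)%R : nat) = i %% m.
Proof. by rewrite val_Zp_nat. Qed.

Lemma in_sitesE i : i < m -> in_sites i%:R%R = (i \in S).
Proof. by move=> ltim; rewrite /in_sites val_natr modn_small. Qed.

(** As j < e, reduction modulo p^e preserves divisibility by p^j and p^(j+1). So each i congruent to
    a member of S carries the exponent q, even if i is not in S. *)
Lemma in_sites_logn i : in_sites i%:R%R -> logn p i = j.
Proof.
rewrite /in_sites val_natr => iS; have ij := Sj iS.
have im_gt0 : 0 < i %% m by case: posnP ij => // ->; rewrite logn0; lia.
have i_gt0 : 0 < i by apply: contraTT im_gt0; rewrite -!eqn0Ngt => /eqP->; rewrite mod0n.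
have dvdE a : a <= e -> (p ^ a %| i %% m) = (p ^ a %| i).
  by move=> lea; rewrite /dvdn modn_dvdm // dvdn_exp2l.
apply/eqP; rewrite eqn_leq -pfactor_dvdn // -dvdE; last exact: ltnW.
rewrite pfactor_dvdn // ij leqnn andbT leqNgt -pfactor_dvdn // -dvdE //.
by rewrite pfactor_dvdn // ij ltnn.
Qed.

(** The separate factor Z_m makes the image of s central of order m. *)
Definition gens (i : nat) : fin_grp E :=
  match i with
  | 0 => (pa _ in_sites, 1%g)
  | 1 => (pb _ _ _, 1%g)
  | 2 => (pt _ _ _, 1%g)
  | 3 => (1%g, (1%R : 'Z_m))
  | _ => 1%g
  end.

Lemma adm_gens : adm k gens.
Proof.
split=> [i lei|i]; first by do 4!(case: i lei => [|i] lei; first by lia).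
case: i => [|[|[|//]]] _; rewrite /= /extprod_mulg /=; congr pair;
  by rewrite ?mul1g ?mulg1.
Qed.


(* H is the kernel of th, with transversal s0 g ** s^n.  The Schreier generators
   of a, b and t do not depend on n, and those of s are trivial unless n = m - 1.
   When kap i g = 0, the relator of z_l at the site i expresses the Schreier
   generator of z_l at (g, n) by those at (g * c_i^a, n) with 0 < a < q, where
   kap i does not vanish: so only the g in nonzero_kap are needed. *)
Lemma small_rank : exists (H : G -> Prop) (a K : nat) (s : seq G),
  is_normal G H /\ has_index G H (p ^ K) /\ (forall x, N x -> H x) /\
  (forall y, List.In y s -> H y) /\ (forall x, H x -> modgen p H N s x) /\
  p ^ K = a * m /\
  q ^ size S * size s <= (4 * q ^ size S + q.-1 ^ size S * (m * k)) * a.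
Proof.
have [th [thM thX]] := liftX adm_gens.
(* The subgroup generated by a, b, t centralizes s, and [th] sends it into the tower factor. *)
pose L0 := gen G (fun y => exists2 i, i < 3 & y = X i).
have sL0 : is_subgroup G L0 by exact: gen_subgroup.
have XL0 i : i < 3 -> L0 (X i) by move=> lti; apply: gen_sub; exists i.
have th4 l : th (X (4 + l)) = 1%g by rewrite thX.
have thM1 x y : (th (x ** y)).1 = ((th x).1 * (th y).1)%g by rewrite thM.
have thM2 x y : (th (x ** y)).2 = ((th x).2 * (th y).2)%g by rewrite thM.
have thV1 x : (th x^v).1 = ((th x).1^-1)%g by rewrite (homV thM).
have thV2 x : (th x^v).2 = ((th x).2^-1)%g by rewrite (homV thM).
have thL0 x : L0 x -> (th x).2 = 1%g.
  move=> Lx; apply: (Lx (fun x => (th x).2 = 1%g)); last first.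
    by move=> _ [[|[|[|//]]] _ ->]; rewrite thX.
  split; first by rewrite (hom1 thM).
  split=> [y z ey ez|y ey]; first by rewrite thM2 ey ez mulg1.
  by rewrite thV2 ey invg1.
pose P0s := [set g : {perm Om} | `[< exists2 x, L0 x & (th x).1 = g >]].
have P0sP g : g \in P0s <-> exists2 x, L0 x & (th x).1 = g.
  by rewrite finset.inE; split=> /asboolP.
have P0g : group_set P0s.
  apply/group_setP; split.
    by apply/P0sP; exists one; [exact: (subg1 sL0)|rewrite (hom1 thM)].
  move=> g h /P0sP[x Lx <-] /P0sP[y Ly <-].
  apply/P0sP; exists (x ** y); first exact: (subgM sL0 Lx Ly).
  exact: thM1.
pose P0 := fingroup.Group P0g.
have P0P g : g \in P0 <-> exists2 x, L0 x & (th x).1 = g by exact: P0sP.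
have thP0 x : (th x).1 \in P0.
  move: x; apply: genX => [|i _].
    split; first by rewrite (hom1 thM); exact: (group1 P0).
    split=> [x y Px Py|x Px]; first by rewrite thM1 groupM.
    by rewrite thV1 groupV.
  case: (ltnP i 3) => [lti|lei]; first by apply/P0P; exists (X i) => //; exact: XL0.
  by rewrite thX; case: i lei => [|[|[|[|i]]]] // _; exact: (group1 P0).
have th_tp x : is_tp (th x).1.
  move: x; apply: genX => [|i _].
    split; first by rewrite (hom1 thM); exact: is_tp1.
    split=> [x y [k1 [f1 [h1 ex]]] [k2 [f2 [h2 ey]]]|x [k1 [f1 [h1 ex]]]].
      by rewrite thM1 ex ey tpM; do 3!eexists.
    by rewrite thV1 ex tpV; do 3!eexists.
  rewrite thX; case: i => [|[|[|[|i]]]] /=; try (by do 3!eexists);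
    exact: is_tp1.
have P0tp g : g \in P0 -> is_tp g by move/P0P=> [x _ <-].
have [K0 cP0] := tp_group_card p_pr e_gt0 j_gt0 P0tp.
have siteL0 i : L0 (site i).
  have [L1 L2] : L0 (X 1) /\ L0 (pow G (X 2) i).
    by split; [exact: XL0|apply: (subgX _ sL0); exact: XL0].
  have LX0 : L0 (X 0) by exact: XL0.
  have LM x y : L0 x -> L0 y -> L0 (x ** y) by exact: (subgM sL0).
  have LV x : L0 x -> L0 x^v by exact: (subgV sL0).
  have Lb : L0 ((pow G (X 2) i)^v ** X 1 ** pow G (X 2) i).
    exact: (LM _ _ (LM _ _ (LV _ L2) L1) L2).
  exact: (LM _ _ (LM _ _ (LV _ LX0) (LV _ Lb)) (LM _ _ LX0 Lb)).
have th_site i : (th (site i)).1 = pcS i.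
  rewrite pc_comm /site (hom_comm thM) !thM !(homV thM) (homX thM) !thX.
  rewrite /Defs.comm /= fin_grp_pow.
  have -> n (x : {perm Om}) (y : 'Z_m) : ((x, y) ^+ n = (x ^+ n, y ^+ n) :> E)%g.
    by elim: n => [|n IH]; rewrite ?expg0 // !expgS IH.
  by [].
have pcP0 i : pcS i \in P0 by rewrite -th_site.
(* Lifts of P0 are taken inside L0 so that they commute with s. *)
have /choice[s0 s0P] g : exists x, g \in P0 -> L0 x /\ (th x).1 = g.
  case: (pselect (g \in P0)) => [/P0P[x Lx <-]|gP]; first by exists x.
  by exists one => /gP.
have sL g : g \in P0 -> L0 (s0 g) by move=> /s0P[].
have s1 g : g \in P0 -> (th (s0 g)).1 = g by move=> /s0P[].
have s2 g : g \in P0 -> (th (s0 g)).2 = 1%g by move=> /sL/thL0.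
have L0C n x : L0 x -> x ** pow G (X 3) n = pow G (X 3) n ** x.
  move=> Lx; apply: pow_comm; apply: (Lx (fun x => x ** X 3 = X 3 ** x)).
    split; first by rewrite !gE.
    split=> [y z ey ez|y ey]; first by rewrite -gmulA ez !gmulA ey.
    by apply: (@gmulgI _ y); rewrite !gE ey !gE.
  by move=> _ [i lti ->]; case: admX => _ /(_ _ lti).
have th3 n : th (pow G (X 3) n) = (1%g, n%:R%R).
  rewrite (homX thM) thX; elim: n => [|n IH]; rewrite ?powS ?IH //.
  by rewrite mulrS; congr pair; exact: mulg1.
have eqE (u v : fin_grp E) : u.1 = v.1 -> u.2 = v.2 -> u = v.
  by case: u v => [u1 u2] [v1 v2] /= -> ->.
pose H x := th x = one.
have nH : is_normal G H.
  apply: (hom_preim_normal thM (S := fun y => y = one)); split.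
    by split=> //; split=> [u v -> ->|u ->]; rewrite ?gE.
  by move=> g u ->; rewrite !gE.
have sH := normal_sub nH.
have HE x y : th x = th y -> H (x ** y^v).
  by rewrite /H thM (homV thM) => ->; rewrite gmulgV.
pose at_ g n := s0 g ** pow G (X 3) n.
have th_at g n : g \in P0 -> th (at_ g n) = (g, n%:R%R).
  move=> gP; rewrite /at_ thM th3; apply: eqE => /=.
    by rewrite s1 // mulg1.
  by rewrite s2 // mul1g.
pose sig x := at_ (th x).1 (th x).2.
have th_sig x : th (sig x) = th x.
  by rewrite th_at ?thP0 // natr_Zp; case: (th x).
have sigE x y : th x = th y -> sig x = sig y by rewrite /sig => ->.
pose XX := nonzero_kap P0 S.
(* Schreier generators: [l1] for a, b, t at n = 0, [l2] for s where n wraps around at m, [l3] for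
   the z_l. Their numbers are 3|P0|, |P0| and |XX| m k. *)
pose l1 := [seq s0 u.1 ** X u.2 ** (s0 (u.1 * (th (X u.2)).1)%g)^v |
  u : {perm Om} * 'I_3 <- enum (finset.setX P0 [set: 'I_3])].
pose l2 := [seq s0 g ** pow G (X 3) m ** (s0 g)^v | g <- enum P0].
pose l3 := [seq at_ u.1 u.2.1 ** X (4 + u.2.2) ** (at_ u.1 u.2.1)^v |
  u : {perm Om} * ('I_m * 'I_k) <- enum (finset.setX XX [set: 'I_m * 'I_k])].
pose s := l1 ++ l2 ++ l3.
have XXP g : g \in XX -> g \in P0 by rewrite finset.inE => /andP[].
have l1P y : List.In y l1 -> exists g i, [/\ g \in P0, i < 3 &
    y = s0 g ** X i ** (s0 (g * (th (X i)).1)%g)^v].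
  move=> /List.in_map_iff[[g i] [<- /InP]].
  by rewrite mem_enum finset.inE => /andP[gP _]; exists g, i.
have l2P y : List.In y l2 -> exists2 g, g \in P0 &
    y = s0 g ** pow G (X 3) m ** (s0 g)^v.
  by move=> /List.in_map_iff[g [<- /InP]]; rewrite mem_enum; exists g.
have l3P y : List.In y l3 -> exists g n l, g \in P0 /\
    y = at_ g n ** X (4 + l) ** (at_ g n)^v.
  move=> /List.in_map_iff[[g [n l]] [<- /InP]].
  rewrite mem_enum finset.inE => /andP[/XXP gP _].
  by exists g, n, l.
have Hs y : List.In y s -> H y.
  case/List.in_app_iff=> [/l1P[g [i [gP lti ->]]]|/List.in_app_iff[/l2P[g gP ->]|/l3P]].
  - have gP' : (g * (th (X i)).1)%g \in P0 by rewrite groupM // thP0.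
    apply: HE; apply: eqE; rewrite ?thM1 ?thM2 ?s1 ?s2 ?thL0 ?mulg1 //; exact: XL0.
  - apply: HE; rewrite thM th3 pchar_Zp //; exact: gmulg1.
  - by move=> [g [n [l [gP ->]]]]; apply: HE; rewrite thM th4; exact: gmulg1.
pose K := modgen p H N s.
have sK : is_subgroup G K by exact: gen_subgroup.
have sinK y : List.In y s -> K y by move=> sy; apply: gen_sub; left.
have NK y : N y -> K y by move=> Ny; apply: gen_sub; right; right.
have KJ h x : H h -> H x -> K x -> K (h ** x ** h^v).
  move=> Hh Hx; apply: (@frattini_conj G p H K) => // y Py.
  by apply: gen_sub; right; left.
have K1 g i : g \in P0 -> i < 3 ->
    K (s0 g ** X i ** (s0 (g * (th (X i)).1)%g)^v).
  move=> gP lti; apply: sinK; apply/List.in_app_iff; left.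
  apply/List.in_map_iff; exists (g, Ordinal lti); split=> //.
  by apply/InP; rewrite mem_enum finset.in_setX gP finset.in_setT.
have K2 g : g \in P0 -> K (s0 g ** pow G (X 3) m ** (s0 g)^v).
  move=> gP; apply: sinK; apply/List.in_app_iff; right.
  apply/List.in_app_iff; left; apply/List.in_map_iff; exists g; split=> //.
  by apply/InP; rewrite mem_enum.
have K3 g n l : g \in XX -> n < m -> l < k ->
    K (at_ g n ** X (4 + l) ** (at_ g n)^v).
  move=> gX ltn ltl; apply: sinK; apply/List.in_app_iff; right.
  apply/List.in_app_iff; right; apply/List.in_map_iff.
  exists (g, (Ordinal ltn, Ordinal ltl)); split=> //.
  by apply/InP; rewrite mem_enum finset.in_setX gX finset.in_setT.
have KL0 g u : g \in P0 -> L0 u -> K (s0 g ** u ** (s0 (g * (th u).1)%g)^v).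
  move=> gP Lu.
  have := @schreier G (fun y => exists2 i, i < 3 & y = X i) K
    (fun x => s0 (th x).1) sK _ u Lu (s0 g).
  rewrite thM1 s1 //; apply=> x _ [i lti ->].
  by rewrite thM1; apply: K1 => //; apply: thP0.
have site_com i n : site i ** pow G (X 3) n = pow G (X 3) n ** site i.
  exact: L0C.
have Kz g n l : g \in P0 -> n < m -> l < k ->
    K (at_ g n ** X (4 + l) ** (at_ g n)^v).
  move=> + ltn ltl.
  (* The induction is on the number of sites of S at which [kap] vanishes. *)
  pose zs (g : {perm Om}) := [set i : 'I_m | ((i : nat) \in S) && (kap i g == 0%R)].
  have [c] := ubnP #|zs g|; elim: c g => // c IH g; rewrite ltnS => lec gP.
  have [allS|] := boolP (all (fun i => kap i g != 0%R) S).
    by apply: K3 => //; rewrite finset.inE gP allS.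
  case/allPn=> i iS; rewrite negbK => /eqP kap0.
  set y := at_ g n; set z := X (4 + l); set ci := site i.
  (* Modulo H, y c_i^a is the representative at [g'], where [kap i] equals -a, nonzero, and the
     other sites are unchanged. *)
  have Kc a : 0 < a -> a < q ->
      K (y ** pow G ci a ** z ** (pow G ci a)^v ** y^v).
    move=> a_gt0 ltaq; pose g' := (g * pcS i ^+ a)%g.
    have gP' : g' \in P0 by rewrite groupM // groupX.
    have thc : th (pow G ci a) = ((pcS i ^+ a)%g, 1%g).
      rewrite (homX thM); elim: (a) => [|a' IHa]; first by rewrite expg0.
      rewrite powS IHa expgS; apply: eqE; first by rewrite -th_site.
      exact: etrans (mulg1 _) (thL0 _ (siteL0 i)).
    have thy : th (y ** pow G ci a) = th (at_ g' n).
      rewrite thM thc !th_at //; apply: eqE => //=; exact: mulg1.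
    have Hh := HE _ _ thy; set h := (X in H X) in Hh.
    have -> : y ** pow G ci a ** z ** (pow G ci a)^v ** y^v =
        h ** (at_ g' n ** z ** (at_ g' n)^v) ** h^v by rewrite /h !gE.
    apply: KJ => //; first by apply: HE; rewrite thM th4; exact: gmulg1.
    apply: IH => //; apply: leq_trans lec; apply: proper_card.
    apply/properP; split; last first.
      exists (Ordinal (Sm iS)); first by rewrite finset.inE /= iS kap0 eqxx.
      have gtp := P0tp g gP; have iin : in_sites i%:R%R by rewrite in_sitesE ?Sm.
      rewrite finset.inE /= iS kap_pc // kap0 sub0r oppr_eq0.
      by rewrite -val_eqE /= val_Zp_nat // modn_small // -lt0n.
    apply/fintype.subsetP => i'; rewrite !finset.inE /= => /andP[i'S].
    have [<- |neq] := eqVneq i (i' : nat).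
      by rewrite kap0 iS eqxx.
    rewrite kap_pc_neq ?i'S //.
    by rewrite -val_eqE /= !val_Zp_nat // !modn_small ?Sm.
  (* The relator puts (z c_i)^q in N, and c_i^q is a word in a, b, t with trivial image in P0, so
     [KL0] applies. *)
  have Kq : K (y ** pow G (z ** ci) q ** (pow G ci q)^v ** y^v).
    have -> : y ** pow G (z ** ci) q ** (pow G ci q)^v ** y^v =
      (y ** pow G (z ** ci) q ** y^v) ** (s0 g ** pow G ci q ** (s0 g)^v)^v.
      have cC : pow G ci q ** pow G (X 3) n = pow G (X 3) n ** pow G ci q.
        exact: (L0C n _ (subgX q sL0 (siteL0 i))).
      have -> : s0 g ** pow G ci q ** (s0 g)^v = y ** pow G ci q ** y^v.
        by rewrite /y /at_ -(gmulA (s0 g) (pow G (X 3) n)) -cC !gE.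
      by rewrite !gE.
    apply: (subgM sK); first by apply: NK; apply: (normalJ _ nN);
      move: (relN l iS); rewrite /prel /= Sj.
    apply: (subgV sK); have := @KL0 g (pow G ci q) gP (subgX _ sL0 (siteL0 i)).
    have -> // : (g * (th (pow G ci q)).1)%g = g.
    have -> a : (th (pow G ci a)).1 = (pcS i ^+ a)%g.
      rewrite (homX thM); elim: a => [|a IHa]; first by rewrite expg0.
      by rewrite powS expgS -IHa -th_site.
    by rewrite pc_expg // mulg1.
  (* As (z c)^(a+1) c^-(a+1) is (z c)^a c^-a times c^a z c^-a, the factors from [Kc] are stripped
     from the right until z remains. *)
  have down a : a < q -> K (y ** pow G (z ** ci) a.+1 ** (pow G ci a.+1)^v ** y^v) ->
      K (y ** z ** y^v).
    elim: a => [_|a IHa lta Ka]; first by rewrite /= !gE.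
    apply: IHa; first exact: ltnW.
    apply: (subgMr sK (Kc a.+1 isT lta)).
    by move: Ka; rewrite !(powSr _ a.+1) !gE.
  by apply: (down q.-1); rewrite ?ltn_predL ?prednK // (ltnW q_gt1').
have Ksig x i : i < k + 4 -> K (sig x ** X i ** (sig (x ** X i))^v).
  move=> lti; rewrite /sig; set g := (th x).1; set n := (th x).2.
  have gP : g \in P0 by exact: thP0.
  have ltnm : n < m by rewrite -[X in _ < X](Zp_cast m_gt1') ltn_ord.
  have [lti3|] := ltnP i 3.
    have -> : (th (x ** X i)).2 = n by rewrite thM2 (thL0 _ (XL0 _ lti3)); exact: mulg1.
    have := K1 g i gP lti3; rewrite thM1 -/g /at_ ginvM.
    by rewrite -(gmulA (s0 g) _ (X i)) -(L0C n _ (XL0 _ lti3)) !gE.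
  rewrite leq_eqVlt => /predU1P[<-|lti3]; last first.
    have iE : i = 4 + (i - 4) by lia.
    have -> : th (x ** X i) = th x by rewrite iE thM th4; exact: gmulg1.
    by rewrite {1}iE; apply: Kz => //; lia.
  have -> : (th (x ** X 3)).1 = g by rewrite thM thX; exact: mulg1.
  have -> : ((th (x ** X 3)).2 : nat) = n.+1 %% m.
    have -> : (th (x ** X 3)).2 = (n + 1)%R by rewrite thM2 thX.
    by rewrite -[X in (X + 1)%R]natr_Zp natr1 val_natr.
  rewrite /at_; case: (ltnP n.+1 m) => [ltm|lem].
    by rewrite modn_small // powSr !gE; exact: (subg1 sK).
  have nE : n.+1 = m by apply/eqP; rewrite eqn_leq lem ltnm.
  by rewrite nE modnn /= gmulg1 -(gmulA (s0 g)) -powSr nE; exact: K2.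
have genall x : gen G (fun y => exists2 i, i < k + 4 & y = X i) x.
  move: x; apply: genX => [|i lti]; first exact: gen_subgroup.
  by apply: gen_sub; exists i.
have HK x : H x -> K x.
  move=> Hx; have th1 : th x = th one by rewrite (hom1 thM).
  have Hc : H (sig one) by rewrite /H th_sig (hom1 thM).
  have := @schreier G _ K sig sK _ x (genall x) one.
  rewrite gmul1 (sigE _ _ th1) => Kx.
  have {}Kx : K (sig one ** x ** (sig one)^v).
    by apply: Kx => y _ [i lti ->]; exact: Ksig.
  have := KJ (sig one)^v _ (subgV sH Hc) (normalJ (sig one) nH Hx) Kx.
  by rewrite !gE.
exists H, #|P0|, (K0 + e), s; split; [exact: nH|split; [|split; [|split; [|split; [|split]]]]].
- have <- : #|finset.setX P0 [set: 'Z_m]| = p ^ (K0 + e).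
    by rewrite cardsX cardsT cP0 card_ord Zp_cast // expnD.
  apply: (@has_index_card G H E _ th) => [x y|x|[g z]].
  + split=> [e1|]; first by rewrite /H thM (homV thM) e1 gmulVg.
    by rewrite /H thM (homV thM) => e1; apply: (@gmulgI _ (th x)^v); rewrite e1 gmulVg.
  + by case: (th x) (thP0 x) => g z gP; rewrite finset.in_setX gP finset.in_setT.
  + rewrite finset.in_setX => /andP[gP _]; exists (at_ g z).
    by rewrite th_at // natr_Zp.
- move=> x /Nrel; apply: ncl_min => // _ [[l i] ->].
  have thz : th (X (4 + l) ** site i) = (pcS i, 1%g).
    rewrite thM th4; apply: eqE; first by rewrite -th_site; exact: mul1g.
    exact: etrans (mul1g _) (thL0 _ (siteL0 i)).
  rewrite /H /prel homX //= thz; set n := p ^ logn p i.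
  (* At residues in S the exponent is exactly q; at the others c_i maps to 1. *)
  have pcn : (pcS i ^+ n)%g = 1%g.
    have [/in_sites_logn ij|ni] := boolP (in_sites i%:R%R).
      by rewrite /n ij pc_expg.
    by rewrite pc_trivial // expg1n.
  suff -> a : pow (fin_grp E) (pcS i, 1%g) a = ((pcS i ^+ a)%g, 1%g) by rewrite pcn.
  elim: a => [|a IHa]; first by rewrite expg0.
  by rewrite powS IHa expgS; apply: eqE => //; exact: mulg1.
- exact: Hs.
- exact: HK.
- by rewrite expnD -cP0.
- have szs : size s = 4 * #|P0| + #|XX| * (m * k).
    rewrite !size_cat !size_map -!cardE !cardsX !cardsT card_prod !card_ord /=.
    by rewrite addnA -mulnSr mulnC.
  have cXX : q ^ size S * #|XX| <= q.-1 ^ size S * #|P0|.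
    apply: card_nonzero_kap => // [|i iS]; last by rewrite in_sitesE // Sm.
    rewrite map_inj_in_uniq // => a b aS bS /(congr1 (fun z : 'Z_m => (z : nat))).
    by rewrite !val_natr !modn_small ?Sm.
  rewrite szs mulnDr mulnA [_ * 4]mulnC -mulnA mulnDl leq_add //.
    by rewrite mulnA.
  by rewrite mulnA [leqRHS]mulnAC leq_mul.
Qed.

End Collapse.

(** * The p-gradient of a quotient *)

Lemma Nat_powE p k : Nat.pow p k = p ^ k.
Proof. by elim: k => //= k ->; rewrite expnS. Qed.

Lemma nth_In (T : Type) (x0 : T) (s : seq T) i : i < size s -> List.In (nth x0 s i) s.
Proof. by elim: s i => // x s IH [|i] lti /=; [left|right; apply: IH]. Qed.

Section QuotientGradient.
Variables (p : nat) (p_pr : prime p) (G Q : Grp) (f : G -> Q) (N : G -> Prop).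
Hypotheses (fM : is_hom f) (fS : forall y, exists x, f x = y)
  (fN : forall x, f x = one <-> N x).

Lemma hom_eq_ker x y : f x = f y -> N (x^v ** y).
Proof. by move=> fxy; apply/fN; rewrite fM (homV fM) fxy gmulVg. Qed.

(** Subgroups of Q pull back to subgroups of the same index containing N, and lifts of generators
    generate the preimage modulo N. *)
Lemma quotient_good_le b : good p b N ->
  forall r, p_gradient_values Q p r -> (b <= r)%Re.
Proof.
move=> gb r [Hb [k [n [nHb [Hbk [[[h [hH Hh]] _] ->]]]]]].
rewrite Nat_powE in Hbk *; pose H x := Hb (f x).
have [lift liftK] := choice fS.
pose s := [seq lift (h i) | i <- iota 0 n].
have sP y : List.In y s <-> exists2 i, i < n & y = lift (h i).
  rewrite List.in_map_iff; split=> [[i [<- /InP]]|[i lti ->]].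
    by rewrite mem_iota add0n; exists i.
  by exists i; split=> //; apply/InP; rewrite mem_iota.
have n_gt0 : (0 < INR (p ^ k))%Re.
  by apply: lt_0_INR; apply/ltP; rewrite expn_gt0 prime_gt0.
suff : (b * INR (p ^ k) <= INR (size s) - 1)%Re.
  rewrite size_map size_iota => le1.
  apply: (Rmult_le_reg_r (INR (p ^ k))) => //.
  by rewrite /Rdiv Rmult_assoc Rinv_l; lra.
apply: (gb H k s).
- exact: hom_preim_normal.
- case: Hbk => rb rbP; exists (lift \o rb) => x.
  have [i [lti [Hi Hj]]] := rbP (f x); exists i; split=> //.
  rewrite /H; split=> [|j' ltj]; rewrite fM (homV fM) /= liftK //.
  exact: Hj.
- by move=> x /fN; rewrite /H => ->; apply: subg1; case: nHb.
- by move=> _ /sP[i lti ->]; rewrite /H liftK; apply: hH; apply/ltP.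
move=> x Hx; pose K := modgen p H N s.
have sK : is_subgroup G K by exact: gen_subgroup.
have [y Ky fyx] : exists2 y, K y & f y = f x.
  apply: (Hh (f x) Hx _ (hom_img fM sK)) => z [[i [lti ->]]|Phiz].
    exists (lift (h i)) => //; apply: gen_sub; left; apply/sP.
    by exists i => //; apply/ltP.
  apply: (Phiz _ (hom_img fM sK)) => _ [[a [c [Ha [Hc ->]]]]|[a [Ha ->]]].
    exists (Defs.comm G (lift a) (lift c)); last by rewrite (hom_comm fM) !liftK.
    apply: gen_sub; right; left; apply: gen_sub; left.
    by exists (lift a), (lift c); rewrite /H !liftK.
  exists (pow G (lift a) p); last by rewrite (homX fM) liftK.
  apply: gen_sub; right; left; apply: gen_sub; right.
  by exists (lift a); rewrite /H liftK.
have Kyx : K (y^v ** x).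
  by apply: gen_sub; right; right; exact: hom_eq_ker.
by move: (subgM sK Ky Kyx); rewrite !gE.
Qed.

(** Since N lies in H, membership in H can be tested in Q. A minimal number of generators exists
    below [size s]. *)
Lemma quotient_le_good b : (forall r, p_gradient_values Q p r -> (b <= r)%Re) ->
  good p b N.
Proof.
move=> lb H k s nH Hk NH sH Hs.
have [sbH HJ] := nH.
pose Hb y := exists2 x, H x & f x = y.
have HbE x : Hb (f x) <-> H x.
  split=> [[y Hy fyx]|Hx]; last by exists x.
  by move: (subgM sbH Hy (NH _ (hom_eq_ker fyx))); rewrite !gE.
have nHb : is_normal Q Hb.
  split; first exact: hom_img.
  move=> g _ [x Hx <-]; have [g' <-] := fS g.
  by rewrite -(homV fM) -!fM; apply/HbE/HJ.
have Hbk : has_index Q Hb (p ^ k).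
  case: Hk => r rP; exists (f \o r) => y; have [x <-] := fS y.
  have [i [lti [Hi Hj]]] := rP x; exists i; split=> //.
  split=> [|j' ltj]; rewrite /= -(homV fM) -fM; first exact/HbE.
  by move/HbE; apply: Hj.
have gs : generates_mod_p Q p Hb (size s).
  exists (fun i => f (nth one s i)); split=> [i /ltP lti|_ [x Hx <-]].
    by apply/HbE/sH/nth_In.
  set T := gen Q _; have sT : is_subgroup Q T by exact: gen_subgroup.
  apply: (Hs x Hx _ (hom_preim fM sT)) => y [sy|[Py|/fN ->]].
  - have [i lti <-] := In_nth one sy; apply: gen_sub; left; exists i.
    by split=> //; apply/ltP.
  - apply: (Py _ (hom_preim fM sT)) => z zP; apply: gen_sub; right; apply: gen_sub.
    case: zP => [[a [c [Ha [Hc ->]]]]|[a [Ha ->]]]; [left|right].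
      by exists (f a), (f c); rewrite (hom_comm fM); do !split=> //; apply/HbE.
    by exists (f a); rewrite (homX fM); split=> //; apply/HbE.
  - exact: subg1.
have exm : exists n, `[< generates_mod_p Q p Hb n >] by exists (size s); apply/asboolP.
case: (ex_minnP exm) => n /asboolP gn nmin.
have dn : dp_is Q p Hb n.
  by split=> // m gm; apply/leP/nmin; apply/asboolP.
have := lb _ (ex_intro _ Hb (ex_intro _ k (ex_intro _ n
  (conj nHb (conj (eq_ind_r (has_index Q Hb) Hbk (Nat_powE p k)) (conj dn erefl)))))).
rewrite Nat_powE => le1.
have n_gt0 : (0 < INR (p ^ k))%Re.
  by apply: lt_0_INR; apply/ltP; rewrite expn_gt0 prime_gt0.
have : (INR n <= INR (size s))%Re.
  by apply: le_INR; apply/leP/nmin; apply/asboolP.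
have := Rmult_le_compat_r _ _ _ (Rlt_le _ _ n_gt0) le1.
rewrite /Rdiv Rmult_assoc Rinv_l; lra.
Qed.

End QuotientGradient.

(** * Primality and real estimates *)

Lemma Zprime_prime p : Znumtheory.prime (Z.of_nat p) -> prime p.
Proof.
move=> p_pr; have := prime_ge_2 _ p_pr => p_ge2.
apply/primeP; split=> [|d /dvdnP[c pE]]; first by lia.
have [|d1|[d1|[dp|dp]]] := prime_divisors _ p_pr (Z.of_nat d).
- by exists (Z.of_nat c); lia.
- by lia.
- by apply/orP; left; apply/eqP; lia.
- by apply/orP; right; apply/eqP; lia.
- by lia.
Qed.

Lemma geometric_small (x c eps : R) : (0 <= x < 1)%Re -> (0 <= c)%Re ->
  (0 < eps)%Re -> exists n, (c * Rpow_def.pow x n < eps)%Re.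
Proof.
move=> [x0 x1] c0 eps0; have c'0 : (0 < c + 1)%Re by lra.
have ax : (Rabs x < 1)%Re by rewrite Rabs_pos_eq.
have [n nP] := pow_lt_1_zero x ax (eps / (c + 1)) (Rdiv_lt_0_compat _ _ eps0 c'0).
exists n; have := nP n (le_n n); rewrite Rabs_pos_eq; last exact: pow_le.
move=> lt1; have xn0 := pow_le x n x0.
have := Rmult_lt_compat_l _ _ _ c'0 lt1.
have -> : ((c + 1) * (eps / (c + 1)) = eps)%Re by field; lra.
lra.
Qed.

Lemma INR_expn x n : INR (x ^ n) = Rpow_def.pow (INR x) n.
Proof. by elim: n => [|n IH]; rewrite ?expn0 // expnS mult_INR IH. Qed.

(** * The maximal set of relators *)

Section Main.
Variables (p : nat) (p_pr : prime p) (k : nat) (G : Grp) (X : nat -> G).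
Hypothesis admX : adm k X.
Hypothesis genX : forall S, is_subgroup G S -> (forall i, i < k + 4 -> S (X i)) ->
  forall x, S x.
Hypothesis liftX : forall (K : Grp) (f : nat -> K), adm k f ->
  exists F : G -> K, is_hom F /\ forall i, F (X i) = f i.
Let rel := prel X p.

Lemma good_base b : (b <= INR k)%Re -> good p b (ncl (rels rel set0)).
Proof.
move=> lebk H K s nH HK _ sH Hs.
have ltks : p ^ K * k < size s.
  apply: (base_rank admX genX liftX p_pr nH HK sH) => x Hx.
  apply: gen_mono (Hs x Hx) => y [sy|[Py|Ny]]; auto.
  right; right; apply: (Ny (fun y => y = one)) => [|_ [g [_ [[i []]]]]].
  by split=> //; split=> [u v -> ->|u ->]; rewrite ?gE.
have : (INR (p ^ K) * INR k + 1 <= INR (size s))%Re.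
  by rewrite -mult_INR -S_INR; apply: le_INR; apply/leP.
have n0 := pos_INR (p ^ K).
have := Rmult_le_compat_r _ _ _ n0 lebk; lra.
Qed.

(** The count in [small_rank] is divided by q^|S| and by the index a m. *)
Lemma good_bound b (S : seq nat) e j (E : set (nat * nat)) : 0 < j -> j < e ->
  uniq S -> (forall i, i \in S -> i < p ^ e) -> (forall i, i \in S -> logn p i = j) ->
  (forall l i, i \in S -> E (l, i)) -> good p b (ncl (rels rel E)) ->
  (b <= 4 / INR (p ^ e) +
    INR k * Rpow_def.pow (1 - / INR (p ^ j)) (size S))%Re.
Proof.
move=> j_gt0 ltje uS Sm Sj SE gE'.
have [||H [a [K [s [nH [HK [NH [sH [Hs [pK les]]]]]]]]]] :=
  small_rank admX genX liftX p_pr j_gt0 ltje uS Sm Sj (ncl_normal _)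
    (N := ncl (rels rel E)).
- by move=> l i /SE Ei; apply: ncl_sub; exists (l, i).
- move=> x; apply: ncl_min; first exact: ncl_normal.
  by move=> y [li _ ->]; apply: ncl_sub; exists li.
have := gE' H K s nH HK NH sH Hs; rewrite pK mult_INR.
have m0 : (0 < INR (p ^ e))%Re.
  by apply: lt_0_INR; apply/ltP; rewrite expn_gt0 prime_gt0.
have a0 : (0 < INR a)%Re.
  apply: lt_0_INR; apply/ltP; have : 0 < p ^ K by rewrite expn_gt0 prime_gt0.
  by rewrite pK muln_gt0 => /andP[].
have q0 : (0 < INR (p ^ j))%Re.
  by apply: lt_0_INR; apply/ltP; rewrite expn_gt0 prime_gt0.
set r := Rpow_def.pow _ _; pose qn := Rpow_def.pow (INR (p ^ j)) (size S).
have qn0 : (0 < qn)%Re by exact: pow_lt.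
have q1E : INR ((p ^ j).-1 ^ size S) = (qn * r)%Re.
  rewrite INR_expn /qn /r -Rpow_mult_distr -subn1 minus_INR; last first.
    by apply/leP; rewrite expn_gt0 prime_gt0.
  by congr Rpow_def.pow; rewrite /=; field; lra.
have /leP/le_INR := les.
rewrite !mult_INR plus_INR !mult_INR q1E INR_expn -/qn.
have -> : INR 4 = 4%Re by rewrite /=; lra.
move: r (INR (p ^ e)) (INR a) (INR k) (INR (size s)) m0 a0 {q1E}.
move=> r m' a' k' x m0 a0 h1 h2.
have h3 : (x <= (4 + r * (m' * k')) * a')%Re.
  apply: (Rmult_le_reg_l qn) => //; apply: Rle_trans h1 _.
  by apply: Req_le; ring.
have h4 : (b * m' * a' <= (4 + r * (m' * k')) * a')%Re.
  by apply: Rle_trans h3; rewrite Rmult_assoc (Rmult_comm m'); lra.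
have h5 := Rmult_le_reg_r _ _ _ a0 h4.
apply: (Rmult_le_reg_r m') => //; apply: Rle_trans h5 _.
by apply: Req_le; field; lra.
Qed.

Lemma sites_exist j n : exists S : seq nat,
  [/\ uniq S, size S = n & forall i, i \in S -> logn p i = j].
Proof.
(* The factor 1 + p x is prime to p, so the valuation is exactly j. *)
exists [seq p ^ j * (1 + p * x) | x <- iota 0 n].
have pj_gt0 : 0 < p ^ j by rewrite expn_gt0 prime_gt0.
split; [|by rewrite size_map size_iota|].
  rewrite map_inj_uniq ?iota_uniq // => x y /eqP.
  rewrite eqn_pmul2l // eqn_add2l eqn_pmul2l ?prime_gt0 //.
  by move/eqP.
move=> _ /mapP[x _ ->]; rewrite lognM // pfactorK // lognE p_pr /=.
by rewrite dvdn_addl ?dvdn_mulr // dvdn1 gtn_eqF ?prime_gt1 // addn0.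
Qed.

Lemma maximal_good a : (0 < a <= INR k)%Re -> exists E : set (nat * nat),
  good p a (ncl (rels rel E)) /\
  forall b, good p b (ncl (rels rel E)) -> (b <= a)%Re.
Proof.
move=> [a0 ak].
have genl x : gen G (fun y => List.In y [seq X i | i <- iota 0 (k + 4)]) x.
  move: x; apply: genX => [|i lti]; first exact: gen_subgroup.
  apply: gen_sub; apply/List.in_map_iff; exists i; split=> //.
  by apply/InP; rewrite mem_iota.
have [F Fgood Ftot|E [Eg Emax]] :=
    @Zorn_bigcup _ (fun E : set (nat * nat) => good p a (ncl (rels rel E))).
  (* [good_bigcup] needs a member of the chain; the empty chain has union [set0], covered by
     [good_base]. *)
  case: (pselect (exists E, F E)) => [[E0 FE0]|F0].
    apply: (@good_bigcup p G _ rel _ a F E0 genl FE0) => // E /Fgood.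
  have -> : bigcup F id = set0; last exact: good_base.
  by apply/seteqP; split=> // x [E FE]; case: F0; exists E.
exists E; split=> // b Eb; apply: Rnot_lt_le => ltab.
have p1 : (1 < INR p)%Re by rewrite -INR_1; apply: lt_INR; apply/ltP/prime_gt1.
have small c eps : (0 <= c)%Re -> (0 < eps)%Re ->
    exists n, forall n', n <= n' -> (c * / INR (p ^ n') < eps)%Re.
  move=> c0 eps0.
  have ip1 : (0 <= / INR p < 1)%Re.
    split; first by apply/Rlt_le/Rinv_0_lt_compat; lra.
    by rewrite -Rinv_1; apply: Rinv_lt_contravar; lra.
  have [n nP] := geometric_small ip1 c0 eps0; exists n => n' len.
  apply: Rle_lt_trans nP; apply: Rmult_le_compat_l => //.
  rewrite pow_inv -INR_expn; apply: Rinv_le_contravar.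
    by apply: lt_0_INR; apply/ltP; rewrite expn_gt0 prime_gt0.
  by apply: le_INR; apply/leP; rewrite leq_exp2l ?prime_gt1.
have [j0 j0P] := small 1%Re (b - a)%Re ltac:(lra) ltac:(lra).
(* Now 1/p^j < b - a; the successor ensures j > 0, as the tower requires. *)
pose j := j0.+1; have jP := j0P j (leqnSn j0).
(* Adding such a relator costs at most 1/q < b - a, so a relator outside E would contradict
   maximality. *)
have allE i l : logn p i = j -> E (l, i).
  move=> ij; apply: contrapT => nE.
  apply: (Emax (setU E (set1 (l, i)))).
    split=> [x Ex|sub]; first exact: or_introl.
    by apply/nE/sub; exact: or_intror.
  apply: (good_power p_pr _ _ Eb (w := X (4 + l) ** site X i) (j := j)).
    by rewrite /rel /prel /= ij.
  lra.
have q1 : (1 < INR (p ^ j))%Re.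
  by rewrite -INR_1; apply: lt_INR; apply/ltP/q_gt1.
have r01 : (0 <= 1 - / INR (p ^ j) < 1)%Re.
  have : (/ INR (p ^ j) < 1)%Re.
    by rewrite -Rinv_1; apply: Rinv_lt_contravar; lra.
  have : (0 < / INR (p ^ j))%Re by apply: Rinv_0_lt_compat; lra.
  lra.
(* Both terms of [good_bound] are pushed below b/2, giving b < b. *)
have b20 : (0 < b / 2)%Re by lra.
have [n nP] := geometric_small r01 (pos_INR k) b20.
have [S [uS sS SJ]] := sites_exist j n.
have [e0 e0P] := small 4%Re (b / 2)%Re ltac:(lra) ltac:(lra).
(* Chosen so that 4/p^e < b/2, j < e, and p^e exceeds every member of S. *)
pose e := (maxn e0 (maxn j.+1 (foldr maxn 0 S))).
have le_foldr (T : seq nat) i : i \in T -> i <= foldr maxn 0 T.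
  elim: T => //= i' T IH.
  by rewrite in_cons leq_max => /predU1P[->|/IH->]; rewrite ?leqnn ?orbT.
have Se i : i \in S -> i < p ^ e.
  move=> iS; apply: leq_ltn_trans (ltn_expl e (prime_gt1 p_pr)).
  apply: leq_trans (leq_maxr e0 _); apply: leq_trans (leq_maxr _ _).
  exact: le_foldr.
have je : j < e by rewrite /e !leq_max leqnn orbT.
have := good_bound (b := b) (S := S) (E := E) (ltn0Sn j0 : 0 < j) je uS Se SJ.
rewrite sS => bd; have {}bd := bd (fun l i iS => allE i l (SJ i iS)) Eb.
have := e0P e (leq_maxl _ _); lra.
Qed.

End Main.

Import Znumtheory.
Open Scope R_scope.

Theorem theorem3p6 (alpha : R) (p : nat) :
  0 < alpha -> prime (Z.of_nat p) ->
  exists G : Group, fin_gen G /\ p_gradient_is G p alpha.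
Proof.
move=> a0 /Zprime_prime p_pr.
have [k kP] : exists k, alpha <= INR k.
  by have [k] := INR_unbounded alpha; exists k; lra.
have [G [X [admX [genX liftX]]]] := base_group_exists k.
have [E [Eg Emax]] := maximal_good p_pr admX genX liftX (conj a0 kP).
have [Q [f [fM [fS fN]]]] := quotient_exists (ncl_normal (rels (prel X p) E)).
exists Q; split.
  exists (k + 4)%N, (f \o X) => y; have [x <-] := fS y; move: x.
  apply: genX => [|i lti]; first by apply: (hom_preim fM); exact: gen_subgroup.
  by apply: gen_sub; exists i; split=> //; apply/ltP.
(* [Eg] makes alpha a lower bound of the gradient values, [Emax] the greatest one. *)
split; first exact: (quotient_good_le p_pr fM fS fN Eg).
by move=> b /(quotient_le_good p_pr fM fS fN); exact: Emax.
Qed.
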